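(* Let $\mathcal{H}=\bigoplus_{n\ge0}\mathcal{H}_n$ be a graded connected Hopf algebra, let $q$ be a scalar, and let $\mathcal{P}$ be a graded basis of the subspace of primitive elements of $\mathcal{H}$. Write $\mathcal{P}=\mathcal{P}_1\amalg\mathcal{P}_{>1}$, where $\mathcal{P}_1$ consists of the elements of degree $1$ and $\mathcal{P}_{>1}$ of those of degree greater than $1$. Fix $n$ and, for $0\le j\le n$, let $E_j$ be the set of elements \[\sum_{i=0}^{j}\sum_{\sigma\in\mathfrak{S}_j}\binom{j}{i}q^{i}(1-q)^{j-i}\,c_{\sigma(1)}\cdots c_{\sigma(i)}\Bigl(\sum_{\tau\in\mathfrak{S}_k}p_{\tau(1)}\cdots p_{\tau(k)}\Bigr)c_{\sigma(i+1)}\cdots c_{\sigma(j)},\] ranging over all multisets $\{c_1,\dots,c_j\}$ of elements of $\mathcal{P}_1$ and all multisets $\{p_1,\dots,p_k\}$ of elements of $\mathcal{P}_{>1}$ with $\deg p_1+\dots+\deg p_k=n-j$. Then $E_j$ is a linearly independent set of eigenvectors of eigenvalue $\frac{j}{n}$ for the operator $\frac1n\bigl(q\,\mathrm{Proj}_1*\iota+(1-q)\,\iota*\mathrm{Proj}_1\bigr):\mathcal{H}_n\to\mathcal{H}_n$. Furthermore, if $\mathcal{H}$ is cocommutative, then $\coprod_{j=0}^{n-2}E_j\amalg E_n$ is a basis of $\mathcal{H}_n$.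
   Context: The ground field is $\mathbb{Q}$ or $\mathbb{R}$. A graded Hopf algebra $\mathcal{H}=\bigoplus_{n\ge0}\mathcal{H}_n$ is connected if $\dim\mathcal{H}_0=1$; each $\mathcal{H}_n$ is finite-dimensional. An element $x$ is primitive if $\Delta(x)=1\otimes x+x\otimes 1$. For linear maps $f,g:\mathcal{H}\to\mathcal{H}$, the convolution is $f*g:=m(f\otimes g)\Delta$; $\iota$ denotes the identity map, and $\mathrm{Proj}_d$ is the projection onto $\mathcal{H}_d$ (identity on $\mathcal{H}_d$, zero on $\mathcal{H}_i$ for $i\ne d$). Products of elements are taken in $\mathcal{H}$; an empty product equals $1$. *)

(* Defs.v *)
From HB Require Import structures.
From mathcomp Require Import all_boot all_order all_algebra.
From mathcomp Require Import fingroup perm generic_quotient ring_quotient.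
From mathcomp Require Import boolp classical_sets.
From mathcomp.multinomials Require Import freeg.

Set Implicit Arguments.
Unset Strict Implicit.
Unset Printing Implicit Defensive.

Import GRing.Theory.

Local Open Scope classical_set_scope.
Local Open Scope ring_scope.

(* The spaces below are infinite-dimensional, so the vectType notions
   (free, basis_of, \dim) do not apply to them. *)

Section LinearAlgebra.
Variables (K : fieldType) (V : lmodType K).
Implicit Types (A U : set V).

Definition span A : set V :=
  [set x | exists2 s : seq (K * V), {in s, forall w, A w.2} &
                                    x = \sum_(w <- s) w.1 *: w.2].

Definition lin_indep A : Prop :=
  forall (s : seq V) (a : V -> K), uniq s -> {in s, forall v, A v} ->
    \sum_(v <- s) a v *: v = 0 -> {in s, forall v, a v = 0}.

Definition is_basis A U : Prop := [/\ A `<=` U, lin_indep A & U `<=` span A].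

Definition has_dim U (d : nat) : Prop :=
  exists s : seq V, [/\ uniq s, size s = d & is_basis [set v | v \in s] U].

Definition eigenvector (T : V -> V) U (a : K) (v : V) : Prop :=
  [/\ U v, v != 0 & T v = a *: v].

Lemma span0 A : span A 0.
Proof. by exists [::] => //; rewrite big_nil. Qed.

Lemma sub_span A : A `<=` span A.
Proof.
move=> x Ax; exists [:: (1, x)]; last by rewrite big_seq1 scale1r.
by move=> w; rewrite inE => /eqP ->.
Qed.

Lemma spanZD A c x y : span A x -> span A y -> span A (c *: x + y).
Proof.
move=> [s As ->] [t At ->]; exists ([seq (c * w.1, w.2) | w <- s] ++ t).
  move=> w; rewrite mem_cat => /orP[/mapP[u us ->]|]; first exact: (As u us).
  exact: At.
rewrite big_cat big_map /= scaler_sumr; congr (_ + _).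
by apply: eq_bigr => w _; rewrite scalerA.
Qed.

End LinearAlgebra.

(* The tensor product of A and B: the free module on A * B modulo the
   submodule generated by the bilinearity relations. *)

Section Tensor.
Variables (K : fieldType) (A B : lmodType K).

Definition free_pairs : Type := {freeg (A * B)%type / K}.
HB.instance Definition _ := GRing.Lmodule.on free_pairs.

Definition fpair (a : A) (b : B) : free_pairs := << (a, b) >>.

Definition tensor_gens : set free_pairs :=
  [set x | (exists c a a' b,
              x = fpair (c *: a + a') b - (c *: fpair a b + fpair a' b)) \/
           (exists c a b b',
              x = fpair a (c *: b + b') - (c *: fpair a b + fpair a b'))].

Definition tensor_rel : {pred free_pairs} := [pred x | `[< span tensor_gens x >]].

Lemma tensor_relP x : reflect (span tensor_gens x) (x \in tensor_rel).
Proof. exact: asboolP. Qed.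

Lemma tensor_rel_zmod_closed : zmod_closed tensor_rel.
Proof.
split=> [|x y]; first by apply/tensor_relP; exact: span0.
move=> /tensor_relP hx /tensor_relP hy; apply/tensor_relP.
by rewrite addrC -scaleN1r; exact: spanZD.
Qed.
HB.instance Definition _ :=
  GRing.isZmodClosed.Build free_pairs tensor_rel tensor_rel_zmod_closed.

Definition tensor : Type := Quotient.quot tensor_rel.
HB.instance Definition _ := GRing.Zmodule.on tensor.
HB.instance Definition _ := EqQuotient.on tensor.

Definition tensor_pi (x : free_pairs) : tensor := \pi_tensor%qT x.

Lemma tensor_piD : {morph tensor_pi : x y / x + y}.
Proof. by move=> x y; rewrite /tensor_pi; exact: (raddfD \pi_(Quotient.quot tensor_rel)%qT). Qed.

Lemma tensor_piP x y :
  tensor_pi x = tensor_pi y <-> span tensor_gens (x - y).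
Proof.
split=> [/eqP|h]; last apply/eqP; rewrite -Quotient.idealrBE.
  by move/tensor_relP.
exact/tensor_relP.
Qed.

Lemma tensor_reprK (x : tensor) : tensor_pi (repr x) = x.
Proof. exact: reprK. Qed.

Definition tensor_scale (c : K) (x : tensor) : tensor :=
  tensor_pi (c *: repr x).

Lemma tensor_scale_pi c x : tensor_scale c (tensor_pi x) = tensor_pi (c *: x).
Proof.
apply/tensor_piP; rewrite -scalerBr -[_ *: _]addr0.
by apply: spanZD; [apply/tensor_piP; exact: tensor_reprK | exact: span0].
Qed.

Lemma tensor_scaleA c d x :
  tensor_scale c (tensor_scale d x) = tensor_scale (c * d) x.
Proof. by rewrite -(tensor_reprK x) !tensor_scale_pi scalerA. Qed.

Lemma tensor_scale1 : left_id 1 tensor_scale.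
Proof. by move=> x; rewrite -(tensor_reprK x) tensor_scale_pi scale1r. Qed.

Lemma tensor_scaleDr : right_distributive tensor_scale +%R.
Proof.
move=> c x y; rewrite -(tensor_reprK x) -(tensor_reprK y).
by rewrite -tensor_piD !tensor_scale_pi scalerDr tensor_piD.
Qed.

Lemma tensor_scaleDl x : {morph tensor_scale^~ x : c d / c + d}.
Proof.
by move=> c d; rewrite -(tensor_reprK x) !tensor_scale_pi scalerDl tensor_piD.
Qed.

HB.instance Definition _ := GRing.Zmodule_isLmodule.Build K tensor
  tensor_scaleA tensor_scale1 tensor_scaleDr tensor_scaleDl.

Lemma tensor_piZ c x : tensor_pi (c *: x) = c *: tensor_pi x.
Proof. by rewrite -tensor_scale_pi. Qed.

Definition pure_tensor (a : A) (b : B) : tensor := tensor_pi (fpair a b).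

Lemma pure_tensor_bilinear : bilinear_for *:%R *:%R pure_tensor.
Proof.
split=> [b c a a'|a c b b']; apply: etrans (_ : tensor_pi (_ *: _ + _) = _);
  try by rewrite tensor_piD tensor_piZ.
  apply/tensor_piP/sub_span; left; by exists c, a, a', b.
by apply/tensor_piP/sub_span; right; exists c, a, b, b'.
Qed.

(* The linear map out of the tensor product induced by a bilinear f; it is
   meaningful only when f is bilinear, see tensor_liftE. *)
Definition tensor_lift (W : lmodType K) (f : A -> B -> W) (x : tensor) : W :=
  fglift (fun ab : A * B => f ab.1 ab.2) (repr x : free_pairs).

End Tensor.

Notation "A ⊗ B" := (tensor A%type B%type) (at level 40, left associativity) : type_scope.
Notation "a ⊗ b" := (pure_tensor a b) (at level 40, left associativity) : ring_scope.

Section TensorLift.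
Variables (K : fieldType) (A B W : lmodType K) (f : A -> B -> W).

Let F := fglift (fun ab : A * B => f ab.1 ab.2) : free_pairs A B -> W.

Let F_add : additive F. Proof. exact: lift_is_additive. Qed.

Let F0 : F 0 = 0. Proof. by rewrite -(subrr 0) F_add subrr. Qed.

Let FD : {morph F : x y / x + y}.
Proof.
by move=> x y; rewrite -[y in LHS]opprK -(add0r (- y)) !F_add F0 add0r opprK.
Qed.

Let FZ c x : F (c *: x) = c *: F x.
Proof.
rewrite -[x]freeg_sumE scaler_sumr !(big_morph F FD F0) scaler_sumr.
apply: eq_bigr => i _; rewrite [F << _ *g i >>]liftU.
have -> : c *: << coeff i x *g i >> = << c * coeff i x *g i >> :> free_pairs A B.
  by apply/eqP/freeg_eqP => k; rewrite coeffZ !coeffU mulrA.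
by rewrite [LHS]liftU scalerA.
Qed.

Hypothesis f_bilin : bilinear_for *:%R *:%R f.

Let F_gens x : span (@tensor_gens K A B) x -> F x = 0.
Proof.
move=> [s hs ->]; rewrite (big_morph F FD F0) big_seq big1 // => w /hs hw.
rewrite FZ; case: hw => [[c [a [a' [b ->]]]]|[c [a [b [b' ->]]]]];
  rewrite F_add FD FZ /F !liftU /= !scale1r.
  by rewrite (f_bilin.1 b) subrr scaler0.
by rewrite (f_bilin.2 a) subrr scaler0.
Qed.

Let lift_pi x : tensor_lift f (tensor_pi x) = F x.
Proof.
apply/eqP; rewrite -subr_eq0 -F_add; apply/eqP/F_gens/tensor_piP.
exact: tensor_reprK.
Qed.

Lemma tensor_liftE a b : tensor_lift f (a ⊗ b) = f a b.
Proof. by rewrite lift_pi /F liftU scale1r. Qed.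

Lemma tensor_lift_linear : linear (tensor_lift f).
Proof.
move=> c x y; rewrite -(tensor_reprK x) -(tensor_reprK y).
rewrite -tensor_piZ -tensor_piD.
by rewrite !lift_pi FD FZ.
Qed.

End TensorLift.

Section TensorSpan.
Variables (K : fieldType) (A B : lmodType K).

Lemma tensor_span (x : A ⊗ B) :
  exists s : seq (A * B), x = \sum_(ab <- s) ab.1 ⊗ ab.2.
Proof.
have pi0 : tensor_pi 0 = 0 :> A ⊗ B.
  by apply: (addrI (tensor_pi 0)); rewrite -tensor_piD !addr0.
have bl b c a a' : (c *: a + a') ⊗ b = c *: (a ⊗ b) + a' ⊗ b :> A ⊗ B.
  exact: (pure_tensor_bilinear A B).1.
have bl0 (b : B) : (0 : A) ⊗ b = 0.
  by have := bl b (-1) 0 0; rewrite scaler0 add0r scaleN1r addNr.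
rewrite -(tensor_reprK x) -[repr x]freeg_sumE.
rewrite (big_morph _ (@tensor_piD K A B) pi0).
exists [seq (coeff ab (repr x) *: ab.1, ab.2) | ab <- dom (repr x)].
rewrite [RHS]big_map; apply: eq_bigr => -[a b] _ /=.
set c := coeff _ _; have := bl b c a 0; rewrite !addr0 bl0 addr0 => ->.
rewrite /pure_tensor -tensor_piZ; congr tensor_pi.
by apply/eqP/freeg_eqP => k; rewrite coeffZ !coeffU mul1r.
Qed.

End TensorSpan.

Section TensorMaps.
Variable K : fieldType.

Definition tensor_map (A B A' B' : lmodType K) (f : A -> A') (g : B -> B') :
  A ⊗ B -> A' ⊗ B' := tensor_lift (fun a b => f a ⊗ g b).

Definition tensor_swap (A B : lmodType K) : A ⊗ B -> B ⊗ A :=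
  tensor_lift (fun a b => b ⊗ a).

Definition tensor_assoc (A B C : lmodType K) : (A ⊗ B) ⊗ C -> A ⊗ (B ⊗ C) :=
  tensor_lift (fun t c => tensor_lift (fun a b => a ⊗ (b ⊗ c)) t).

Definition tensor_fold (H : algType K) : H ⊗ H -> H :=
  tensor_lift (fun a b => a * b).

Definition tensor_mul (H : algType K) (x y : H ⊗ H) : H ⊗ H :=
  tensor_lift (fun a b =>
    tensor_lift (fun a' b' => (a * a') ⊗ (b * b')) y) x.

End TensorMaps.

Section Hopf.
Variables (K : fieldType) (H : algType K).

Definition convolution (D : H -> H ⊗ H) (f g : H -> H) : H -> H :=
  fun x => tensor_fold (tensor_map f g (D x)).

Record hopf_algebra := HopfAlgebra {
  comul : {linear H -> (H ⊗ H)%type};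
  counit : {linear H -> K^o};
  antipode : {linear H -> H};
  comulA : forall x, tensor_assoc (tensor_map comul idfun (comul x)) =
                     tensor_map idfun comul (comul x);
  counitl : forall x, tensor_lift (fun a b => counit a *: b) (comul x) = x;
  counitr : forall x, tensor_lift (fun a b => counit b *: a) (comul x) = x;
  comul1 : comul 1 = 1 ⊗ 1;
  comulM : forall x y, comul (x * y) = tensor_mul (comul x) (comul y);
  counit1 : counit 1 = 1;
  counitM : forall x y, counit (x * y) = counit x * counit y;
  antipodel : forall x, convolution comul antipode idfun x = (counit x)%:A;
  antipoder : forall x, convolution comul idfun antipode x = (counit x)%:A
}.

Definition cocommutative (h : hopf_algebra) : Prop :=
  forall x, tensor_swap (comul h x) = comul h x.

Definition primitive (h : hopf_algebra) : set H :=
  [set x | comul h x = 1 ⊗ x + x ⊗ 1].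

(* A decomposition of H as the internal direct sum of the subspaces piece d,
   carried by the projections Proj d onto the summands. *)
Record grading := Grading {
  piece :> nat -> set H;
  Proj : nat -> {linear H -> H};
  piece0 : forall d, piece d 0;
  pieceZD : forall d c x y, piece d x -> piece d y -> piece d (c *: x + y);
  Proj_in : forall d x, piece d (Proj d x);
  Proj_id : forall d x, piece d x -> Proj d x = x;
  Proj_eq0 : forall d i x, i != d -> piece i x -> Proj d x = 0;
  Proj_sum : forall x, exists N : nat, x = \sum_(d < N) Proj d x
}.

Record is_graded (h : hopf_algebra) (G : grading) : Prop := IsGraded {
  graded_one : G 0%N 1;
  graded_mul : forall i j x y, G i x -> G j y -> G (i + j)%N (x * y);
  graded_comul : forall n x, G n x ->
    span [set t | exists i j a b, [/\ (i + j)%N = n, G i a, G j b & t = a ⊗ b]]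
      (comul h x);
  graded_counit : forall n x, (0 < n)%N -> G n x -> counit h x = 0;
  graded_antipode : forall n x, G n x -> G n (antipode h x)
}.

Record graded_connected_hopf (h : hopf_algebra) (G : grading) : Prop :=
  GradedConnectedHopf {
    hopf_graded : is_graded h G;
    hopf_finite_dim : forall n, exists d, has_dim (G n) d;
    hopf_connected : has_dim (G 0%N) 1
  }.

Definition graded_basis (G : grading) (P U : set H) : Prop :=
  is_basis P U /\ (forall p, P p -> exists d, G d p).

(* The degree of a nonzero homogeneous element; a junk value otherwise. *)
Definition degree (G : grading) (x : H) : nat := xget 0%N [set d | G d x].

Definition deg_eq1 (G : grading) (P : set H) : set H :=
  [set p | P p /\ degree G p = 1%N].

Definition deg_gt1 (G : grading) (P : set H) : set H :=
  [set p | P p /\ (1 < degree G p)%N].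

Definition sym_prod (k : nat) (p : k.-tuple H) : H :=
  \sum_(t : 'S_k) \prod_(b < k) tnth p (t b).

Definition eigenvec (q : K) (j k : nat) (c : j.-tuple H) (p : k.-tuple H) : H :=
  \sum_(i < j.+1) \sum_(s : 'S_j)
    ('C(j, i)%:R * q ^+ i * (1 - q) ^+ (j - i)) *:
      ((\prod_(a < j | (a < i)%N) tnth c (s a)) * sym_prod p *
       (\prod_(a < j | (i <= a)%N) tnth c (s a))).

(* Multisets are given by tuples enumerating them: eigenvec is symmetric in
   the entries of c and in those of p. *)
Definition eigenset (G : grading) (P : set H) (q : K) (n j : nat) : set H :=
  [set v | exists k (c : j.-tuple H) (p : k.-tuple H),
     [/\ {in c, forall x, deg_eq1 G P x},
         {in p, forall x, deg_gt1 G P x},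
         (\sum_(x <- p) degree G x = n - j)%N &
         v = eigenvec q c p]].

Definition shuffle_op (h : hopf_algebra) (G : grading) (q : K) (n : nat) :
    H -> H :=
  fun x => n%:R^-1 *:
    (q *: convolution (comul h) (Proj G 1) idfun x +
     (1 - q) *: convolution (comul h) idfun (Proj G 1) x).

End Hopf.

(* Main.v *)
Require Import Defs.
From HB Require Import structures.
From mathcomp Require Import all_boot all_order all_algebra.
From mathcomp Require Import all_fingroup.
From mathcomp Require Import boolp classical_sets.
From mathcomp Require Import ring.

(* On a product of primitive elements, Proj_1 * iota sums the words obtained by
   moving one letter of degree 1 to the front, and iota * Proj_1 those obtained
   by moving one such letter to the back.  On the symmetrized words W_i with i
   of the letters c in front of the block of the p's this gives
     (Proj_1 * iota) W_i = i W_i + (j - i) W_(i+1),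
     (iota * Proj_1) W_i = i W_(i-1) + (j - i) W_i,
   and the binomial weights combine the W_i into an eigenvector.

   Independence: filter H by the number of primitive factors.  Since commutators
   of primitives are primitive, letters commute modulo lower filtration, and the
   eigenvector of (c, p) has leading term j! k! c_1 ... c_j p_1 ... p_k.  For a
   linear form f dual to some p in P, (f (x) id) Delta sends a word, modulo lower
   filtration, to the multiplicity of p times the word with p removed; induction
   on the length then shows that words which are not permutations of each other
   are independent modulo lower filtration.

   Spanning: let D multiply each H_n by n and let S be the antipode.  If H is
   cocommutative then d = S * D takes primitive values, and n x = D x is the sum
   of the x_(1) d(x_(2)), where only x_(1) of degree less than n contribute.  By
   induction H is spanned by words in P, and the leading terms turn words into
   eigenvectors. *)

Set Implicit Arguments.
Unset Strict Implicit.
Unset Printing Implicit Defensive.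

Import GRing.Theory Num.Theory.

Local Open Scope classical_set_scope.
Local Open Scope ring_scope.

(* all_algebra shadows the span of Defs by the finite-dimensional one. *)
Local Notation span := Defs.span.

(** * Linear and bilinear maps given as bare functions, and spans *)

Section Linear.
Variables (K : fieldType) (V W : lmodType K) (f : V -> W).
Hypothesis lf : linear f.

Lemma lin_sum (I : Type) (r : seq I) (F : I -> V) :
  f (\sum_(i <- r) F i) = \sum_(i <- r) f (F i).
Proof.
pose g : {linear V -> W} := HB.pack f (GRing.isLinear.Build K V W _ f lf).
exact: (linear_sum g).
Qed.

Lemma linD x y : f (x + y) = f x + f y.
Proof. by rewrite -[x]scale1r lf !scale1r. Qed.

Lemma lin0 : f 0 = 0.
Proof. by apply: (addrI (f 0)); rewrite -linD !addr0. Qed.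

Lemma linZ a x : f (a *: x) = a *: f x.
Proof. by rewrite -[a *: x]addr0 lf lin0 addr0. Qed.

Lemma linB x y : f (x - y) = f x - f y.
Proof. by rewrite -scaleN1r linD linZ scaleN1r. Qed.

End Linear.

Section Span.
Variables (K : fieldType) (V : lmodType K).
Implicit Types (A B U : set V).

Lemma span_ind A U : U 0 -> (forall c x y, A x -> U y -> U (c *: x + y)) ->
  forall x, span A x -> U x.
Proof.
move=> U0 UZD _ [s As ->]; elim: s As => [|w s IH] As; first by rewrite big_nil.
rewrite big_cons; apply: UZD; first by apply: As; rewrite mem_head.
by apply: IH => u us; apply: As; rewrite inE us orbT.
Qed.

Lemma span_trans A B : A `<=` span B -> span A `<=` span B.
Proof.
move=> AB; apply: span_ind => [|c x y /AB]; [exact: span0 | exact: spanZD].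
Qed.

Lemma span_mono A B : A `<=` B -> span A `<=` span B.
Proof. by move=> AB; apply: span_trans => x /AB; exact: Defs.sub_span. Qed.

Lemma spanZ A c x : span A x -> span A (c *: x).
Proof. by move=> Ax; rewrite -[_ *: _]addr0; apply: spanZD => //; exact: span0. Qed.

Lemma spanD A x y : span A x -> span A y -> span A (x + y).
Proof. by move=> Ax Ay; rewrite -[x]scale1r; exact: spanZD. Qed.

Lemma spanB A x y : span A x -> span A y -> span A (x - y).
Proof. by move=> Ax Ay; rewrite addrC -scaleN1r; exact: spanZD. Qed.

Lemma span_sum A (I : eqType) (r : seq I) (Q : pred I) (F : I -> V) :
  (forall i, i \in r -> Q i -> span A (F i)) -> span A (\sum_(i <- r | Q i) F i).
Proof.
move=> h; rewrite big_seq_cond; apply: big_ind; first exact: span0.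
  exact: spanD.
by move=> i /andP[]; exact: h.
Qed.

Lemma lin_indep_mono A B : A `<=` B -> lin_indep B -> lin_indep A.
Proof. by move=> AB iB s a us sA; apply: iB => // v /sA; exact: AB. Qed.

Lemma lin_indep_neq0 A v : lin_indep A -> A v -> v != 0.
Proof.
move=> iA Av; apply/eqP => v0.
have sA : {in [:: v], forall w, A w} by move=> w; rewrite inE => /eqP ->.
have := iA [:: v] (fun=> 1) isT sA; rewrite big_seq1 v0 scaler0 => /(_ erefl 0).
by rewrite inE eqxx => /(_ isT)/eqP; rewrite oner_eq0.
Qed.

Lemma span_lin (W : lmodType K) (f : V -> W) A (B : set W) : linear f ->
  (forall x, A x -> span B (f x)) -> forall x, span A x -> span B (f x).
Proof.
move=> lf AB; apply: span_ind => [|c x y /AB Ax By]; rewrite /= ?lin0 ?lf //.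
  exact: span0.
exact: spanZD.
Qed.

End Span.

Section Bilinear.
Variables (K : fieldType) (A B W : lmodType K).

Definition is_bilin (F : A -> B -> W) : Prop :=
  (forall b, linear (F^~ b)) /\ (forall a, linear (F a)).

Variable F : A -> B -> W.
Hypothesis bF : is_bilin F.

Lemma is_bilinP : bilinear_for *:%R *:%R F.
Proof. by case: bF => l r; split. Qed.

Lemma tensor_lift_pure a b : tensor_lift F (a ⊗ b) = F a b.
Proof. exact: (tensor_liftE is_bilinP). Qed.

Lemma tensor_lift_lin : linear (tensor_lift F).
Proof. exact: (tensor_lift_linear is_bilinP). Qed.

Lemma tensor_lift_sum (s : seq (A * B)) :
  tensor_lift F (\sum_(w <- s) w.1 ⊗ w.2) = \sum_(w <- s) F w.1 w.2.
Proof.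
rewrite (lin_sum tensor_lift_lin); apply: eq_bigr => w _.
exact: tensor_lift_pure.
Qed.

End Bilinear.

(** Needed for lifts nested inside lifts: on one decomposition of [t] into pure tensors, linearity
    holds term by term. *)
Lemma tensor_lift_linear_param (K : fieldType) (A B V W : lmodType K)
    (F : V -> A -> B -> W) (t : A ⊗ B) :
  (forall v, is_bilin (F v)) -> (forall a b, linear (fun v => F v a b)) ->
  linear (fun v => tensor_lift (F v) t).
Proof.
move=> bF lF c v v'; have [s ->] := tensor_span t.
rewrite !tensor_lift_sum // scaler_sumr -big_split.
by apply: eq_bigr => w _; rewrite lF.
Qed.

Lemma pure_bilin (K : fieldType) (A B : lmodType K) :
  is_bilin (@pure_tensor K A B).
Proof. by have [l r] := pure_tensor_bilinear A B; split. Qed.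

(** * Sweedler calculus *)

Section Sweedler.
Variables (K : fieldType) (H : algType K) (h : hopf_algebra H).
Implicit Types (x y : H) (W : lmodType K).

(* Sweedler notation: cosum F x stands for the sum of the F x_(1) x_(2); for F
   not bilinear it depends on the choice made in coseq. *)
Definition coseq x : seq (H * H) := sval (cid (tensor_span (comul h x))).

Definition cosum W (F : H -> H -> W) x : W := \sum_(w <- coseq x) F w.1 w.2.

Lemma coseqE x : comul h x = \sum_(w <- coseq x) w.1 ⊗ w.2.
Proof. exact: (svalP (cid (tensor_span (comul h x)))). Qed.

Lemma eq_cosum W (F F' : H -> H -> W) x :
  (forall a b, F a b = F' a b) -> cosum F x = cosum F' x.
Proof. by move=> e; apply: eq_bigr => w _. Qed.

Lemma tensor_lift_comul W (F : H -> H -> W) x :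
  is_bilin F -> tensor_lift F (comul h x) = cosum F x.
Proof.
move=> bF; rewrite coseqE lin_sum; last exact: tensor_lift_lin.
by apply: eq_bigr => w _; rewrite tensor_lift_pure.
Qed.

Lemma cosum_linear W (F : H -> H -> W) : is_bilin F -> linear (cosum F).
Proof.
move=> bF c x y.
by rewrite -!tensor_lift_comul // linearP; exact: tensor_lift_lin.
Qed.

Lemma lin_cosum W W' (f : W -> W') (F : H -> H -> W) x :
  linear f -> f (cosum F x) = cosum (fun a b => f (F a b)) x.
Proof. by move=> lf; rewrite /cosum lin_sum. Qed.

Lemma cosumD W (F F' : H -> H -> W) x :
  cosum (fun a b => F a b + F' a b) x = cosum F x + cosum F' x.
Proof. exact: big_split. Qed.

Lemma cosumB W (F F' : H -> H -> W) x :
  cosum (fun a b => F a b - F' a b) x = cosum F x - cosum F' x.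
Proof. exact: sumrB. Qed.

Lemma cosum0 W x : cosum (fun _ _ => 0 : W) x = 0.
Proof. exact: big1. Qed.

Definition is_trilin W (F : H -> H -> H -> W) : Prop :=
  [/\ forall b c, linear (fun a => F a b c), forall a c, linear (fun b => F a b c)
    & forall a b, linear (fun c => F a b c)].

(** Coassociativity in Sweedler form: [F] induces a linear map [T] on [H ⊗ (H ⊗ H)], which is
    applied to both sides of [comulA]. *)
Lemma cosumA W (F : H -> H -> H -> W) x : is_trilin F ->
  cosum (fun a c => cosum (fun a1 a2 => F a1 a2 c) a) x =
  cosum (fun a b => cosum (fun b1 b2 => F a b1 b2) b) x.
Proof.
move=> [F1 F2 F3]; have [pl pr] := pure_bilin H H.
have [pl' pr'] := pure_bilin H (H ⊗ H)%type.
have [pl'' pr''] := pure_bilin (H ⊗ H)%type H.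
pose T := tensor_lift (fun a t => tensor_lift (F a) t).
have bF a : is_bilin (F a) by split=> ?; [exact: F2 | exact: F3].
have bT : is_bilin (fun a t => tensor_lift (F a) t).
  by split=> [t|a]; [exact: tensor_lift_linear_param | exact: tensor_lift_lin].
have lT : linear T by exact: tensor_lift_lin.
have bQ (c : H) : is_bilin (fun a b : H => a ⊗ (b ⊗ c)).
  split=> [b|a] k u v; first by rewrite pl'.
  by rewrite (pl c) pr'.
have bQ' : is_bilin (fun (t : H ⊗ H) (c : H) =>
    tensor_lift (fun a b : H => a ⊗ (b ⊗ c)) t).
  split=> [c|t]; first exact: tensor_lift_lin.
  by apply: tensor_lift_linear_param => // a b k u v; rewrite pr pr'.
have := comulA h x; move/(congr1 T).
rewrite /tensor_map tensor_lift_comul; last first.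
  split=> [b|a] k u v; first by rewrite /= linearP pl''.
  by rewrite pr''.
rewrite tensor_lift_comul; last first.
  split=> [b|a] k u v; first by rewrite pl'.
  by rewrite /= linearP pr'.
rewrite /tensor_assoc (lin_cosum _ _ (tensor_lift_lin bQ')).
rewrite !(lin_cosum _ _ lT) => e.
transitivity (\sum_(w <- coseq x) T (w.1 ⊗ comul h w.2)).
  rewrite -[RHS]e; apply: eq_bigr => w _; rewrite tensor_lift_pure //.
  rewrite tensor_lift_comul // lin_cosum //; apply: eq_cosum => a b.
  by rewrite /T !tensor_lift_pure.
apply: eq_bigr => w _; rewrite /T tensor_lift_pure //.
exact: tensor_lift_comul.
Qed.

Lemma cosum_counitl W (f : H -> W) x : linear f ->
  cosum (fun a b => (counit h a : K) *: f b) x = f x.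
Proof.
move=> lf; rewrite -[in RHS](counitl h x) tensor_lift_comul; last first.
  split=> [b|a] c u v; first by rewrite linearP scalerDl scalerA.
  by rewrite scalerDr !scalerA mulrC.
by rewrite lin_cosum //; apply: eq_cosum => a b; rewrite linZ.
Qed.

Lemma cosum_counitr W (f : H -> W) x : linear f ->
  cosum (fun a b => (counit h b : K) *: f a) x = f x.
Proof.
move=> lf; rewrite -[in RHS](counitr h x) tensor_lift_comul; last first.
  split=> [b|a] c u v; last by rewrite linearP scalerDl scalerA.
  by rewrite scalerDr !scalerA mulrC.
by rewrite lin_cosum //; apply: eq_cosum => a b; rewrite linZ.
Qed.

Lemma cosumC W (F : H -> H -> W) x : cocommutative h -> is_bilin F ->
  cosum F x = cosum (fun a b => F b a) x.
Proof.
move=> /(_ x) cc bF; have [pl pr] := pure_bilin H H.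
rewrite -tensor_lift_comul // -cc /tensor_swap tensor_lift_comul; last first.
  by split=> [b|a] c u v; rewrite ?pl ?pr.
rewrite lin_cosum; last exact: tensor_lift_lin.
by apply: eq_cosum => a b; rewrite tensor_lift_pure.
Qed.

Lemma mul_bilin : is_bilin (fun x y : H => x * y).
Proof.
split=> [b|a] c u v; first by rewrite mulrDl scalerAl.
by rewrite mulrDr scalerAr.
Qed.

Lemma tensor_mul_pure (a b a' b' : H) :
  tensor_mul (a ⊗ b) (a' ⊗ b') = (a * a') ⊗ (b * b').
Proof.
have [pl pr] := pure_bilin H H; have [ml mr] := mul_bilin.
have bi u v : is_bilin (fun a' b' : H => (u * a') ⊗ (v * b')).
  by split=> [?|?] c x y; rewrite mr ?pl ?pr.
rewrite /tensor_mul tensor_lift_pure; first by rewrite tensor_lift_pure.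
split=> [v|u] c x y; rewrite !tensor_lift_pure // ml ?pl ?pr //.
Qed.

Lemma tensor_mul_bilin : is_bilin (@tensor_mul K H).
Proof.
have [pl pr] := pure_bilin H H; have [ml mr] := mul_bilin.
have bi u v : is_bilin (fun a' b' : H => (u * a') ⊗ (v * b')).
  by split=> [?|?] c x y; rewrite mr ?pl ?pr.
have bi2 (y : H ⊗ H) : is_bilin (fun a b : H =>
    tensor_lift (fun a' b' : H => (a * a') ⊗ (b * b')) y).
  by split=> [v|u]; apply: tensor_lift_linear_param => // a b c u1 u2;
    rewrite ml ?pl ?pr.
split=> [y|x]; first exact: tensor_lift_lin.
by apply: tensor_lift_linear_param => // a b; exact: tensor_lift_lin.
Qed.

Lemma tensor_mulA : associative (@tensor_mul K H).
Proof.
have [ml mr] := tensor_mul_bilin => x y z.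
have [r ->] := tensor_span x; have [s ->] := tensor_span y.
have [t ->] := tensor_span z.
rewrite !(lin_sum (ml _)); apply: eq_bigr => u _.
rewrite [LHS](lin_sum (mr _)) [X in _ = tensor_mul X _](lin_sum (mr _)).
rewrite [RHS](lin_sum (ml _)).
apply: eq_bigr => v _.
rewrite !(lin_sum (mr _)); apply: eq_bigr => w _.
by rewrite !tensor_mul_pure !mulrA.
Qed.

Lemma tensor_mul1 (x : H ⊗ H) : tensor_mul (1 ⊗ 1) x = x.
Proof.
have [ml mr] := tensor_mul_bilin; have [s ->] := tensor_span x.
rewrite (lin_sum (mr _)); apply: eq_bigr => w _.
by rewrite tensor_mul_pure !mul1r.
Qed.

Lemma comul_mul x y : comul h (x * y) = tensor_mul (comul h x) (comul h y).
Proof. exact: comulM. Qed.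

Lemma cosum1 W (F : H -> H -> W) : is_bilin F -> cosum F 1 = F 1 1.
Proof. by move=> bF; rewrite -tensor_lift_comul // comul1 tensor_lift_pure. Qed.

Lemma cosum_prim W (F : H -> H -> W) x : is_bilin F -> primitive h x ->
  cosum F x = F 1 x + F x 1.
Proof.
move=> bF px; rewrite -tensor_lift_comul // px.
by rewrite (linD (tensor_lift_lin bF)) !tensor_lift_pure.
Qed.

(** As Delta is multiplicative and [Delta x = 1 ⊗ x + x ⊗ 1], left multiplication by [x] acts on one
    tensor factor at a time. *)
Lemma cosum_priml W (F : H -> H -> W) x y : is_bilin F -> primitive h x ->
  cosum F (x * y) = cosum (fun a b => F (x * a) b + F a (x * b)) y.
Proof.
move=> bF px; have [ml mr] := tensor_mul_bilin; have lF := tensor_lift_lin bF.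
rewrite -tensor_lift_comul // comul_mul px [comul h y]coseqE.
rewrite (linD (ml _)) !(lin_sum (mr _)) (linD lF) !(lin_sum lF) -big_split /=.
apply: eq_bigr => w _.
by rewrite !tensor_mul_pure !tensor_lift_pure // !mul1r addrC.
Qed.

Lemma cosum_primr W (F : H -> H -> W) x y : is_bilin F -> primitive h x ->
  cosum F (y * x) = cosum (fun a b => F (a * x) b + F a (b * x)) y.
Proof.
move=> bF px; have [ml mr] := tensor_mul_bilin; have lF := tensor_lift_lin bF.
rewrite -tensor_lift_comul // comul_mul px [comul h y]coseqE.
rewrite (linD (mr _)) !(lin_sum (ml _)) (linD lF) !(lin_sum lF) -big_split /=.
apply: eq_bigr => w _.
by rewrite !tensor_mul_pure !tensor_lift_pure // !mulr1 addrC.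
Qed.

(** The counit axiom reads [x = x + eps(x) 1], and 1 is nonzero. *)
Lemma counit_prim x : primitive h x -> (counit h x : K) = 0.
Proof.
move=> px; have := cosum_counitl x (f := idfun) (fun _ _ _ => erefl).
rewrite cosum_prim //; last first.
  split=> [b|a] c u v /=; first by rewrite linearP scalerDl scalerA.
  by rewrite scalerDr !scalerA mulrC.
rewrite counit1 scale1r /= => /(canRL (addKr _)); rewrite addNr => /eqP.
by rewrite scaler_eq0 oner_eq0 orbF => /eqP.
Qed.

(** In [Delta (x y) - Delta (y x)] the mixed tensors [x ⊗ y] and [y ⊗ x] cancel. *)
Lemma primitive_comm x y : primitive h x -> primitive h y ->
  primitive h (x * y - y * x).
Proof.
move=> px py; have [ml mr] := tensor_mul_bilin; have [pl pr] := pure_bilin H H.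
rewrite /primitive /= linearB /= !comul_mul px py.
rewrite !(linD (ml _)) !(linD (mr _)) !tensor_mul_pure !mul1r !mulr1.
rewrite (linB (pl _)) (linB (pr _)).
rewrite [1 ⊗ (y * x) + _ + _]addrACA opprD addrACA; congr (_ + _).
  by rewrite (addrC (1 ⊗ (y * x))) addrKA.
by rewrite (addrC (x ⊗ y)) addrKA.
Qed.

End Sweedler.

(** * Moving letters in symmetrized words *)

Section Words.
Variables (K : fieldType) (A : algType K).
Implicit Types (s : seq A) (Z : A).

(** The summand of W_i for one ordering of the letters c, with [Z] standing for the block of the
    p's. *)
Definition sandwich Z (i : nat) s : A :=
  (\prod_(x <- take i s) x) * Z * (\prod_(x <- drop i s) x).

(** [move_back] and [move_front] are polymorphic in the letters, so that they can be performed on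
    positions instead; see [sum_perm_natural]. *)
Definition move_back (T : Type) (a : nat) (s : seq T) : seq T :=
  take a s ++ rot 1 (drop a s).

Definition move_front (T : Type) (a : nat) (s : seq T) : seq T :=
  rotr 1 (take a.+1 s) ++ drop a.+1 s.

Lemma move_back0 (T : Type) x (s : seq T) : move_back 0 (x :: s) = rcons s x.
Proof. by rewrite /move_back take0 drop0 rot1_cons. Qed.

Lemma move_backS (T : Type) a x (s : seq T) :
  move_back a.+1 (x :: s) = x :: move_back a s.
Proof. by []. Qed.

Lemma move_front_rcons (T : Type) a x (s : seq T) : (a < size s)%N ->
  move_front a (rcons s x) = rcons (move_front a s) x.
Proof.
move=> lt_as; rewrite /move_front -!cats1 takel_cat // drop_cat -catA.
case: (ltnP a.+1 (size s)) => // le_sa; congr (_ ++ _).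
by rewrite (drop_oversize le_sa) (_ : (a.+1 - size s = 0)%N) //; apply/eqP.
Qed.

Lemma move_front_last (T : Type) x (s : seq T) :
  move_front (size s) (rcons s x) = x :: s.
Proof.
rewrite /move_front -(size_rcons s x) take_size drop_size cats0.
by rewrite -rot1_cons rotK.
Qed.

Lemma size_move_front (T : Type) a (s : seq T) : size (move_front a s) = size s.
Proof. by rewrite /move_front size_cat size_rotr -size_cat cat_take_drop. Qed.

Lemma map_move_back (T T' : Type) (f : T -> T') a (s : seq T) :
  map f (move_back a s) = move_back a (map f s).
Proof. by rewrite /move_back map_cat map_rot map_take map_drop. Qed.

Lemma map_move_front (T T' : Type) (f : T -> T') a (s : seq T) :
  map f (move_front a s) = move_front a (map f s).
Proof. by rewrite /move_front map_cat map_rotr map_take map_drop. Qed.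

Lemma perm_move_back (T : eqType) a (s : seq T) : perm_eq (move_back a s) s.
Proof. by rewrite /move_back -{3}(cat_take_drop a s) perm_cat2l perm_rot. Qed.

Lemma perm_move_front (T : eqType) a (s : seq T) : perm_eq (move_front a s) s.
Proof.
by rewrite /move_front -{3}(cat_take_drop a.+1 s) perm_cat2r perm_rotr.
Qed.

Lemma sandwich0 Z s : sandwich Z 0 s = Z * \prod_(x <- s) x.
Proof. by rewrite /sandwich take0 drop0 big_nil mul1r. Qed.

Lemma sandwichS Z i x s : sandwich Z i.+1 (x :: s) = x * sandwich Z i s.
Proof. by rewrite /sandwich /= big_cons !mulrA. Qed.

Lemma sandwich_size Z s : sandwich Z (size s) s = (\prod_(x <- s) x) * Z.
Proof. by rewrite /sandwich take_size drop_size big_nil mulr1. Qed.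

Lemma sandwich_rcons Z i s x : (i <= size s)%N ->
  sandwich Z i (rcons s x) = sandwich Z i s * x.
Proof.
move=> le_is; rewrite /sandwich -cats1 takel_cat // drop_cat.
case: (ltnP i (size s)) => [lt_is|le_si].
  by rewrite big_cat big_seq1 !mulrA.
have -> : (i - size s = 0)%N by apply/eqP.
by rewrite (drop_oversize le_si) big_nil mulr1 drop0 big_seq1.
Qed.

Lemma prod_rcons s x : \prod_(y <- rcons s x) y = (\prod_(y <- s) y) * x.
Proof. by rewrite -cats1 big_cat big_seq1. Qed.

(** [R] models iota * Proj_1 on letters of degree 1: a letter either stays while [R] acts further
    right, or jumps to the back. *)
Lemma op_back_prod (R : A -> A) s : R 1 = 0 ->
  {in s, forall x, forall y, R (x * y) = x * R y + y * x} ->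
  R (\prod_(x <- s) x) = \sum_(a < size s) \prod_(x <- move_back a s) x.
Proof.
move=> R1; elim: s => [|x s IH] Rs; first by rewrite big_ord0 big_nil.
rewrite big_cons Rs ?mem_head // IH; last first.
  by move=> y ys; apply: Rs; rewrite inE ys orbT.
rewrite big_ord_recl addrC move_back0 prod_rcons; congr (_ + _).
by rewrite mulr_sumr; apply: eq_bigr => a _; rewrite move_backS big_cons.
Qed.

Lemma op_front_prod (L : A -> A) s : L 1 = 0 ->
  {in s, forall x, forall y, L (y * x) = L y * x + x * y} ->
  L (\prod_(x <- s) x) = \sum_(a < size s) \prod_(x <- move_front a s) x.
Proof.
move=> L1; elim/last_ind: s => [|s x IH] Ls; first by rewrite big_ord0 big_nil.
rewrite prod_rcons Ls ?mem_rcons ?mem_head // IH; last first.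
  by move=> y ys; apply: Ls; rewrite mem_rcons inE ys orbT.
rewrite size_rcons big_ord_recr /= move_front_last big_cons; congr (_ + _).
rewrite mulr_suml; apply: eq_bigr => a _.
by rewrite move_front_rcons // prod_rcons.
Qed.

(** A letter taken from the front of [Z] (position [a < i]) leaves one letter fewer before [Z]; one
    taken from behind [Z] leaves that number unchanged. *)
Lemma op_back_sandwich (R : A -> A) Z i s : R 1 = 0 ->
  {in s, forall x, forall y, R (x * y) = x * R y + y * x} ->
  (forall y, R (Z * y) = Z * R y) -> (i <= size s)%N ->
  R (sandwich Z i s) = \sum_(a < size s) sandwich Z (i - (a < i)) (move_back a s).
Proof.
move=> R1 + RZ; elim: s i => [|x s IH] [|i] //= Rs le_is.
- by rewrite sandwich0 RZ big_nil R1 mulr0 big_ord0.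
- rewrite sandwich0 RZ op_back_prod // mulr_sumr.
  by apply: eq_bigr => a _; rewrite sandwich0.
rewrite sandwichS Rs ?mem_head // IH //; last first.
  by move=> y ys; apply: Rs; rewrite inE ys orbT.
rewrite big_ord_recl addrC move_back0 /= subn1 sandwich_rcons //; congr (_ + _).
rewrite mulr_sumr; apply: eq_bigr => a _.
rewrite move_backS /= /bump /= add1n ltnS -sandwichS; congr sandwich.
case: (ltnP a i) => [lt_ai|_]; rewrite ?subn0 //.
by rewrite -subSn // (leq_ltn_trans _ lt_ai).
Qed.

(** The mirror image, by induction from the right end: a letter from behind [Z] that moves to the
    front adds one letter before [Z]. *)
Lemma op_front_sandwich (L : A -> A) Z i s : L 1 = 0 ->
  {in s, forall x, forall y, L (y * x) = L y * x + x * y} ->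
  (forall y, L (y * Z) = L y * Z) -> (i <= size s)%N ->
  L (sandwich Z i s) =
  \sum_(a < size s) sandwich Z (i + (i <= a)) (move_front a s).
Proof.
move=> L1 + LZ; elim/last_ind: s i => [|s x IH] i Ls.
  rewrite leqn0 => /eqP ->.
  by rewrite sandwich0 big_nil mulr1 -(mul1r Z) LZ L1 mul0r big_ord0.
rewrite size_rcons leq_eqVlt => /orP[/eqP ->|].
  rewrite -{1}(size_rcons s x) sandwich_size LZ op_front_prod // mulr_suml.
  rewrite size_rcons; apply: eq_bigr => a _.
  by rewrite leqNgt ltn_ord addn0 -sandwich_size size_move_front size_rcons.
rewrite ltnS => le_is.
rewrite sandwich_rcons // Ls ?mem_rcons ?mem_head // IH //; last first.
  by move=> y ys; apply: Ls; rewrite mem_rcons inE ys orbT.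
rewrite big_ord_recr /= move_front_last le_is addn1 sandwichS; congr (_ + _).
rewrite mulr_suml; apply: eq_bigr => a _.
rewrite move_front_rcons // sandwich_rcons // size_move_front.
by case: (leqP i a) => [le_ia|_]; rewrite ?addn0 // addn1 (leq_ltn_trans le_ia).
Qed.

End Words.

(** * Symmetrized sandwiches and their binomial recombination *)

Section SymSum.
Variables (K : fieldType) (A : algType K) (j : nat) (c : j.-tuple A).

Definition permute (s : 'S_j) : seq A := [seq tnth c (s a) | a <- enum 'I_j].

Lemma size_permute s : size (permute s) = j.
Proof. by rewrite size_map size_enum_ord. Qed.

Lemma perm_permute s : perm_eq (permute s) c.
Proof.
apply/tuple_permP; exists s.
by rewrite /permute -val_ord_tuple.
Qed.

(* By naturality, mv is composition with one fixed permutation of positions. *)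
Lemma sum_perm_natural (f : seq A -> A) (mv : forall T : Type, seq T -> seq T) :
  (forall T T' (g : T -> T') s, map g (mv T s) = mv T' (map g s)) ->
  perm_eq (mv 'I_j (enum 'I_j)) (enum 'I_j) ->
  \sum_(s : 'S_j) f (mv A (permute s)) = \sum_(s : 'S_j) f (permute s).
Proof.
move=> mvN; rewrite -{2}val_ord_tuple => /tuple_permP[t Et].
rewrite [RHS](reindex_inj (mulgI t)); apply: eq_bigr => s _; congr f.
rewrite /permute -mvN Et -map_comp /=; apply: eq_map => a /=.
by rewrite permM tnth_ord_tuple.
Qed.

Definition sym_sandwich (Z : A) (i : nat) : A :=
  \sum_(s : 'S_j) sandwich Z i (permute s).

(** After symmetrization the order of the moved word no longer matters, only the number of letters
    before [Z]: [i] positions lower it and [j - i] keep it. At [i = 0] the junk index [i.-1] has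
    coefficient 0. *)
Lemma op_back_sym (R : A -> A) Z i : linear R -> R 1 = 0 ->
  {in c, forall x, forall y, R (x * y) = x * R y + y * x} ->
  (forall y, R (Z * y) = Z * R y) -> (i <= j)%N ->
  R (sym_sandwich Z i) =
    i%:R *: sym_sandwich Z i.-1 + (j - i)%:R *: sym_sandwich Z i.
Proof.
move=> lR R1 Rc RZ le_ij; rewrite lin_sum //.
transitivity (\sum_(0 <= a < j) sym_sandwich Z (i - (a < i))).
  rewrite big_mkord.
  under eq_bigr => s _.
    rewrite op_back_sandwich ?size_permute //; last first.
      by move=> x; rewrite (perm_mem (perm_permute s)); exact: Rc.
    over.
  rewrite exchange_big /=; apply: eq_bigr => a _.
  rewrite (sum_perm_natural _ (mv := fun T => @move_back T a)) //.
    by move=> *; exact: map_move_back.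
  exact: perm_move_back.
rewrite (big_cat_nat _ le_ij) //=; congr (_ + _); rewrite scaler_nat.
  rewrite -[X in _ *+ X]subn0 -sumr_const_nat; apply: eq_big_nat => a /= lt_ai.
  by rewrite lt_ai subn1.
rewrite -sumr_const_nat; apply: eq_big_nat => a /andP[le_ia _].
by rewrite ltnNge le_ia subn0.
Qed.

Lemma op_front_sym (L : A -> A) Z i : linear L -> L 1 = 0 ->
  {in c, forall x, forall y, L (y * x) = L y * x + x * y} ->
  (forall y, L (y * Z) = L y * Z) -> (i <= j)%N ->
  L (sym_sandwich Z i) =
    i%:R *: sym_sandwich Z i + (j - i)%:R *: sym_sandwich Z i.+1.
Proof.
move=> lL L1 Lc LZ le_ij; rewrite lin_sum //.
transitivity (\sum_(0 <= a < j) sym_sandwich Z (i + (i <= a))).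
  rewrite big_mkord.
  under eq_bigr => s _.
    rewrite op_front_sandwich ?size_permute //; last first.
      by move=> x; rewrite (perm_mem (perm_permute s)); exact: Lc.
    over.
  rewrite exchange_big /=; apply: eq_bigr => a _.
  rewrite (sum_perm_natural _ (mv := fun T => @move_front T a)) //.
    by move=> *; exact: map_move_front.
  exact: perm_move_front.
rewrite (big_cat_nat _ le_ij) //=; congr (_ + _); rewrite scaler_nat.
  rewrite -[X in _ *+ X]subn0 -sumr_const_nat; apply: eq_big_nat => a /= lt_ai.
  by rewrite leqNgt lt_ai addn0.
rewrite -sumr_const_nat; apply: eq_big_nat => a /andP[le_ia _].
by rewrite le_ia addn1.
Qed.

(** With weights B_i, the identity [(1 - q) (i + 1) B_(i+1) = q (j - i) B_i] trades the
    index-shifted part of [q L] for an unshifted one with factor [1 - q], and that of [(1 - q) R]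
    for one with factor [q]. The unshifted parts then have total factor [q + (1 - q) = 1], and
    [i + (j - i) = j] is the eigenvalue. *)
Lemma sum_binom_op (q : K) (L R : A -> A) Z : linear L -> linear R ->
  (forall i, (i <= j)%N -> L (sym_sandwich Z i) =
    i%:R *: sym_sandwich Z i + (j - i)%:R *: sym_sandwich Z i.+1) ->
  (forall i, (i <= j)%N -> R (sym_sandwich Z i) =
    i%:R *: sym_sandwich Z i.-1 + (j - i)%:R *: sym_sandwich Z i) ->
  let v := \sum_(i < j.+1)
    ('C(j, i)%:R * q ^+ i * (1 - q) ^+ (j - i)) *: sym_sandwich Z i in
  q *: L v + (1 - q) *: R v = j%:R *: v.
Proof.
move=> lL lR EL ER v; pose B i := 'C(j, i)%:R * q ^+ i * (1 - q) ^+ (j - i).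
pose W := sym_sandwich Z.
have Ev : v = \sum_(0 <= i < j.+1) B i *: W i by rewrite big_mkord.
have -> : L v = \sum_(0 <= i < j.+1) (B i * i%:R) *: W i +
                \sum_(0 <= i < j.+1) (B i * (j - i)%:R) *: W i.+1.
  rewrite Ev !big_mkord lin_sum // -big_split; apply: eq_bigr => i _ /=.
  by rewrite linZ // EL -1?ltnS // scalerDr !scalerA.
have -> : R v = \sum_(0 <= i < j.+1) (B i * i%:R) *: W i.-1 +
                \sum_(0 <= i < j.+1) (B i * (j - i)%:R) *: W i.
  rewrite Ev !big_mkord lin_sum // -big_split; apply: eq_bigr => i _ /=.
  by rewrite linZ // ER -1?ltnS // scalerDr !scalerA.
(* The out-of-range terms vanish: [W j.+1] has coefficient [j - j], and [W 0.-1] has coefficient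
   0. *)
rewrite [X in _ *: (_ + X) + _]big_nat_recr //= subnn mulr0 scale0r addr0.
rewrite [X in _ + _ *: (X + _)]big_nat_recl //= mulr0 scale0r add0r.
have EB i : (i < j)%N -> (1 - q) * (B i.+1 * i.+1%:R) = q * (B i * (j - i)%:R).
  move=> lt_ij; have := congr1 (fun m => m%:R : K) (mul_bin_left j i).
  rewrite /B /= !natrM -{2}(subnSK lt_ij) !exprS.
  set u := i.+1%:R; set C := 'C(j, i.+1)%:R; set r := (1 - q) ^+ _ => E.
  transitivity (q * q ^+ i * (1 - q) * r * (u * C)); first by ring.
  by rewrite E; ring.
have E23 : q *: \sum_(0 <= i < j) (B i * (j - i)%:R) *: W i.+1 =
           (1 - q) *: \sum_(0 <= i < j.+1) (B i * i%:R) *: W i.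
  rewrite [in RHS]big_nat_recl //= mulr0 scale0r add0r !scaler_sumr.
  by apply: eq_big_nat => i /= lt_ij; rewrite !scalerA EB.
have E32 : (1 - q) *: \sum_(0 <= i < j) (B i.+1 * i.+1%:R) *: W i =
           q *: \sum_(0 <= i < j.+1) (B i * (j - i)%:R) *: W i.
  rewrite [in RHS]big_nat_recr //= subnn mulr0 scale0r addr0 !scaler_sumr.
  by apply: eq_big_nat => i /= lt_ij; rewrite !scalerA EB.
rewrite !scalerDr E23 E32 -!scalerDl.
rewrite [q + (1 - q)]addrC subrK !scale1r Ev scaler_sumr -big_split.
apply: eq_big_nat => i /andP[_ le_ij] /=; rewrite -scalerDl scalerA -mulrDr -natrD.
by rewrite subnKC // mulrC.
Qed.

End SymSum.

(** With [drop_enum_ord], matches the products of [eigenvec], filtered by position, with the [take]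
    and [drop] of [sandwich]. *)
Lemma take_enum_ord j i :
  take i (enum 'I_j) = [seq a : 'I_j <- enum 'I_j | (a < i)%N].
Proof.
apply: (inj_map val_inj); rewrite map_take val_enum_ord.
rewrite -[RHS](filter_map (val : 'I_j -> nat) (fun a : nat => (a < i)%N) _).
rewrite val_enum_ord.
rewrite take_iota; case: (leqP i j) => [le_ij|lt_ji].
  by rewrite (filter_iota_ltn 0 le_ij).
apply/esym/all_filterP/allP => a; rewrite mem_iota /= add0n => lt_aj.
exact: ltn_trans lt_ji.
Qed.

Lemma drop_enum_ord j i :
  drop i (enum 'I_j) = [seq a : 'I_j <- enum 'I_j | (i <= a)%N].
Proof.
apply: (inj_map val_inj); rewrite map_drop val_enum_ord.
rewrite -[RHS](filter_map (val : 'I_j -> nat) (fun a : nat => (i <= a)%N) _).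
rewrite val_enum_ord drop_iota add0n.
case: (leqP i j) => [le_ij|lt_ji]; last first.
  rewrite (eqP (ltnW lt_ji : j - i == 0)%N) /=.
  rewrite (eq_in_filter (a2 := pred0)) ?filter_pred0 // => a.
  by rewrite mem_iota /= add0n => lt_aj; rewrite leqNgt (ltn_trans lt_aj).
rewrite -{2}(subnKC le_ij) iotaD filter_cat add0n.
rewrite (eq_in_filter (a2 := pred0)) => [|a]; last first.
  by rewrite mem_iota /= add0n ltnNge => /negbTE ->.
rewrite filter_pred0; apply/esym/all_filterP/allP => a.
by rewrite mem_iota => /andP[].
Qed.

Lemma eigenvecE (K : fieldType) (A : algType K) (q : K) j k
    (c : j.-tuple A) (p : k.-tuple A) :
  eigenvec q c p = \sum_(i < j.+1)
    ('C(j, i)%:R * q ^+ i * (1 - q) ^+ (j - i)) *: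
      sym_sandwich c (sym_prod p) i.
Proof.
apply: eq_bigr => i _; rewrite -scaler_sumr; congr (_ *: _).
apply: eq_bigr => s _; rewrite /sandwich /permute -map_take -map_drop.
rewrite take_enum_ord drop_enum_ord !big_map !big_filter.
by rewrite !enumT ![index_enum _]unlock.
Qed.

(** * The eigenvector property *)

Section Graded.
Variables (K : realFieldType) (H : algType K) (h : hopf_algebra H).
Variables (G : grading H) (hG : graded_connected_hopf h G).

Let gG : is_graded h G := hopf_graded hG.

Lemma piece_sum d (I : eqType) (r : seq I) (Q : pred I) (F : I -> H) :
  (forall i, i \in r -> Q i -> G d (F i)) -> G d (\sum_(i <- r | Q i) F i).
Proof.
move=> GF; rewrite big_seq_cond; apply: big_ind; first exact: piece0.
  by move=> x y Gx Gy; rewrite -[x]scale1r; exact: pieceZD.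
by move=> i /andP[]; exact: GF.
Qed.

Lemma pieceZ d c x : G d x -> G d (c *: x).
Proof.
by move=> Gx; rewrite -[_ *: _]addr0; apply: pieceZD => //; exact: piece0.
Qed.

Lemma piece_uniq i j x : x != 0 -> G i x -> G j x -> i = j.
Proof.
move=> x0 Gi Gj; apply/eqP; apply: contraNT x0 => ne_ij.
by rewrite -(Proj_id Gj) (Proj_eq0 ne_ij Gi).
Qed.

Lemma piece_prod (s : seq H) (dg : H -> nat) : {in s, forall x, G (dg x) x} ->
  G (\sum_(x <- s) dg x)%N (\prod_(x <- s) x).
Proof.
elim: s => [|x s IH] Gs; first by rewrite !big_nil; exact: graded_one gG.
rewrite !big_cons; apply: (graded_mul gG); first by apply: Gs; rewrite mem_head.
by apply: IH => y ys; apply: Gs; rewrite inE ys orbT.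
Qed.

Lemma piece_degree x d : x != 0 -> G d x -> degree G x = d.
Proof.
move=> x0 Gx; apply: (piece_uniq x0) => //.
exact: (xgetPex 0%N (ex_intro (fun d => G d x) d Gx)).
Qed.

(** Connectedness makes H_0 the line through 1, and the counit, being 1 there, reads off the
    coefficient. *)
Lemma piece0_scalar a : G 0%N a -> a = (counit h a : K) *: 1.
Proof.
have [s [_ + [+ _]]] := hopf_connected hG; case: s => [|v []] // _ sG G0s.
have Gv : G 0 v by apply: sG; rewrite /= mem_head.
have span1 x : G 0%N x -> exists c, x = c *: v.
  move/G0s; apply: (span_ind (U := fun x => exists c, x = c *: v)) => [|c y z].
    by exists 0; rewrite scale0r.
  by rewrite /= inE => /eqP -> [d ->]; exists (c + d); rewrite scalerDl.
have [c1 E1] := span1 _ (graded_one gG).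
have c10 : c1 != 0.
  by apply/eqP => c0; move/eqP: E1; rewrite c0 scale0r oner_eq0.
move=> /span1[c Ec].
have {}Ec : a = (c / c1) *: 1 by rewrite Ec E1 scalerA divfK.
have -> : (counit h a : K) = c / c1 by rewrite Ec linearZ /= counit1; exact: mulr1.
exact: Ec.
Qed.

Lemma lin_piece_ext (W : lmodType K) (f g : H -> W) : linear f -> linear g ->
  (forall d x, G d x -> f x = g x) -> f =1 g.
Proof.
move=> lf lg fg x; have [N ->] := Proj_sum G x.
by rewrite !lin_sum //; apply: eq_bigr => d _; apply/fg/Proj_in.
Qed.

Lemma Proj0E a : Proj G 0%N a = (counit h a : K) *: 1.
Proof.
apply: (lin_piece_ext (f := Proj G 0) (g := fun a => (counit h a : K) *: 1)).
- exact: linearP.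
- by move=> c x y; rewrite linearP scalerDl scalerA.
move=> [|d] x Gx; first by rewrite (Proj_id Gx); exact: piece0_scalar.
by rewrite (graded_counit gG _ Gx) // scale0r (Proj_eq0 _ Gx).
Qed.

Lemma Proj_mull i d x a : G i x -> Proj G (i + d) (x * a) = x * Proj G d a.
Proof.
move=> Gx; have [_ mr] := mul_bilin H.
apply: (lin_piece_ext (f := fun a => Proj G (i + d) (x * a))
                      (g := fun a => x * Proj G d a)).
- by move=> c u v; rewrite mr linearP.
- by move=> c u v; rewrite linearP mr.
move=> e y Gy; have Gxy := graded_mul gG Gx Gy.
case: (eqVneq e d) => [<-|ne_ed]; first by rewrite !Proj_id.
by rewrite (Proj_eq0 _ Gxy) ?eqn_add2l // (Proj_eq0 ne_ed Gy) mulr0.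
Qed.

Lemma Proj_mulr i d x a : G i x -> Proj G (d + i) (a * x) = Proj G d a * x.
Proof.
move=> Gx; have [ml _] := mul_bilin H.
apply: (lin_piece_ext (f := fun a => Proj G (d + i) (a * x))
                      (g := fun a => Proj G d a * x)).
- by move=> c u v; rewrite ml linearP.
- by move=> c u v; rewrite linearP ml.
move=> e y Gy; have Gyx := graded_mul gG Gy Gx.
case: (eqVneq e d) => [<-|ne_ed]; first by rewrite !Proj_id.
by rewrite (Proj_eq0 _ Gyx) ?eqn_add2r // (Proj_eq0 ne_ed Gy) mul0r.
Qed.

Lemma Proj_mul_lt i d x a : (d < i)%N -> G i x ->
  Proj G d (x * a) = 0 /\ Proj G d (a * x) = 0.
Proof.
move=> lt_di Gx; have [ml mr] := mul_bilin H; split.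
  apply: (lin_piece_ext (f := fun a => Proj G d (x * a)) (g := fun=> 0)).
  - by move=> c u v; rewrite mr linearP.
  - by move=> c u v; rewrite scaler0 addr0.
  move=> e y Gy; rewrite (Proj_eq0 _ (graded_mul gG Gx Gy)) //.
  by rewrite gtn_eqF //; apply: leq_trans lt_di _; rewrite ?leq_addr ?leq_addl.
apply: (lin_piece_ext (f := fun a => Proj G d (a * x)) (g := fun=> 0)).
- by move=> c u v; rewrite ml linearP.
- by move=> c u v; rewrite scaler0 addr0.
move=> e y Gy; rewrite (Proj_eq0 _ (graded_mul gG Gy Gx)) //.
by rewrite gtn_eqF //; apply: leq_trans lt_di _; rewrite ?leq_addr ?leq_addl.
Qed.

(** [coseq] may pick inhomogeneous tensors, so homogeneity cannot be read off its terms; the sum is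
    turned into [tensor_lift], where [graded_comul] supplies homogeneous ones. *)
Lemma cosum_piece (W : lmodType K) (F : H -> H -> W) (U : set W) n x :
  is_bilin F -> U 0 -> (forall c u v, U u -> U v -> U (c *: u + v)) ->
  (forall i j a b, (i + j)%N = n -> G i a -> G j b -> U (F a b)) ->
  G n x -> U (cosum h F x).
Proof.
move=> bF U0 UZD UF Gx; rewrite -tensor_lift_comul //.
have lF := tensor_lift_lin bF; move: (graded_comul gG Gx).
apply: (span_ind (U := fun t => U (tensor_lift F t))); first by rewrite lin0.
move=> c t t' [i [j [a [b [ij Ga Gb ->]]]]] Ut'.
by rewrite lF tensor_lift_pure //; apply: UZD => //; exact: UF ij Ga Gb.
Qed.

Definition Proj1_id (x : H) : H := cosum h (fun a b => Proj G 1 a * b) x.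
Definition id_Proj1 (x : H) : H := cosum h (fun a b => a * Proj G 1 b) x.

Lemma Proj1_id_bilin : is_bilin (fun a b : H => Proj G 1 a * b).
Proof.
have [ml mr] := mul_bilin H; split=> [b|a] c u v; last exact: mr.
by rewrite linearP ml.
Qed.

Lemma id_Proj1_bilin : is_bilin (fun a b : H => a * Proj G 1 b).
Proof.
have [ml mr] := mul_bilin H; split=> [b|a] c u v; first exact: ml.
by rewrite linearP mr.
Qed.

Lemma Proj1_id_linear : linear Proj1_id.
Proof. exact/cosum_linear/Proj1_id_bilin. Qed.

Lemma id_Proj1_linear : linear id_Proj1.
Proof. exact/cosum_linear/id_Proj1_bilin. Qed.

Lemma Proj11 : Proj G 1 1 = 0.
Proof. exact: (Proj_eq0 (i := 0)) (graded_one gG). Qed.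

Lemma Proj1_id1 : Proj1_id 1 = 0.
Proof. by rewrite /Proj1_id cosum1 ?Proj11 ?mul0r //; exact: Proj1_id_bilin. Qed.

Lemma id_Proj11 : id_Proj1 1 = 0.
Proof. by rewrite /id_Proj1 cosum1 ?Proj11 ?mulr0 //; exact: id_Proj1_bilin. Qed.

(** If [x] goes to the left tensor factor it stays in place. If it goes to the right one,
    [Proj_1 (x b) = eps(b) x] and the counit axiom leaves [y x]. *)
Lemma id_Proj1_deg1 x y : primitive h x -> G 1%N x ->
  id_Proj1 (x * y) = x * id_Proj1 y + y * x.
Proof.
move=> px Gx; have [ml mr] := mul_bilin H.
rewrite /id_Proj1 cosum_priml ?cosumD //; last exact: id_Proj1_bilin.
rewrite (lin_cosum _ _ _ (mr x)); congr (_ + _).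
  by apply: eq_cosum => a b; rewrite mulrA.
rewrite -(cosum_counitr h y (ml x)); apply: eq_cosum => a b.
by rewrite (Proj_mull 0 b Gx : Proj G 1 (x * b) = _) Proj0E -!scalerAr mulr1.
Qed.

Lemma Proj1_id_deg1 x y : primitive h x -> G 1%N x ->
  Proj1_id (y * x) = Proj1_id y * x + x * y.
Proof.
move=> px Gx; have [ml mr] := mul_bilin H.
rewrite /Proj1_id cosum_primr ?cosumD //; last exact: Proj1_id_bilin.
rewrite (lin_cosum _ _ _ (ml x)) addrC; congr (_ + _).
  by apply: eq_cosum => a b; rewrite mulrA.
rewrite -(cosum_counitl h y (mr x)); apply: eq_cosum => a b.
by rewrite (Proj_mulr 0 a Gx : Proj G 1 (a * x) = _) Proj0E -!scalerAl mul1r.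
Qed.

(** When [x] enters the right tensor factor, that factor has no component of degree 1, so only the
    other term survives. *)
Lemma id_Proj1_deg_gt1 d x y : (1 < d)%N -> primitive h x -> G d x ->
  id_Proj1 (x * y) = x * id_Proj1 y.
Proof.
move=> d1 px Gx; have [ml mr] := mul_bilin H.
rewrite /id_Proj1 cosum_priml; [|exact: id_Proj1_bilin|by []].
rewrite (lin_cosum _ _ _ (mr x)); apply: eq_cosum => a b.
by rewrite (Proj_mul_lt _ d1 Gx).1 mulr0 addr0 mulrA.
Qed.

Lemma Proj1_id_deg_gt1 d x y : (1 < d)%N -> primitive h x -> G d x ->
  Proj1_id (y * x) = Proj1_id y * x.
Proof.
move=> d1 px Gx; have [ml mr] := mul_bilin H.
rewrite /Proj1_id cosum_primr; [|exact: Proj1_id_bilin|by []].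
rewrite (lin_cosum _ _ _ (ml x)); apply: eq_cosum => a b.
by rewrite (Proj_mul_lt _ d1 Gx).2 mul0r add0r mulrA.
Qed.

Lemma convolutionE (f g : H -> H) x : linear f -> linear g ->
  convolution (comul h) f g x = cosum h (fun a b => f a * g b) x.
Proof.
move=> lf lg; have [ml mr] := mul_bilin H; have [pl pr] := pure_bilin H H.
rewrite /convolution /tensor_map tensor_lift_comul; last first.
  by split=> [b|a] c u v; rewrite ?lf ?lg ?pl ?pr.
rewrite /tensor_fold (lin_cosum _ _ _ (tensor_lift_lin (mul_bilin H))).
by apply: eq_cosum => a b; rewrite tensor_lift_pure //; exact: mul_bilin.
Qed.

Lemma shuffle_opE q n x :
  shuffle_op h G q n x = n%:R^-1 *: (q *: Proj1_id x + (1 - q) *: id_Proj1 x).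
Proof.
by rewrite /shuffle_op !convolutionE //; try exact: linearP.
Qed.

Lemma shuffle_op_piece q n x : G n x -> G n (shuffle_op h G q n x).
Proof.
move=> Gx; have Gm i j a b : (i + j)%N = n -> G i a -> G j b -> G n (a * b).
  by move=> <- Ga Gb; exact: (graded_mul gG Ga Gb).
have GZD c u v := @pieceZD _ _ G n c u v.
rewrite shuffle_opE; apply/pieceZ/pieceZD; last apply: pieceZ.
  apply: (cosum_piece Proj1_id_bilin (piece0 G n) GZD _ Gx) => i j a b ij Ga Gb.
  case: (eqVneq i 1%N) => [i1|ne_i1].
    by rewrite i1 in ij Ga; rewrite Proj_id //; exact: Gm ij Ga Gb.
  by rewrite (Proj_eq0 ne_i1 Ga) mul0r; exact: piece0.
apply: (cosum_piece id_Proj1_bilin (piece0 G n) GZD _ Gx) => i j a b ij Ga Gb.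
case: (eqVneq j 1%N) => [j1|ne_j1].
  by rewrite j1 in ij Gb; rewrite Proj_id //; exact: Gm ij Ga Gb.
by rewrite (Proj_eq0 ne_j1 Gb) mulr0; exact: piece0.
Qed.

Variables (P : set H) (hP : graded_basis G P (primitive h)).

Lemma basis_prim p : P p -> primitive h p.
Proof. by case: hP => [[]] PP _ _ _; exact: PP. Qed.

Lemma basis_neq0 p : P p -> p != 0.
Proof. by case: hP => [[_ iP _] _]; exact: lin_indep_neq0. Qed.

Lemma basis_piece p : P p -> G (degree G p) p.
Proof.
move=> Pp; have [_ /(_ _ Pp)[d Gp]] := hP.
by rewrite (piece_degree (basis_neq0 Pp) Gp).
Qed.

(** A basis element of degree 0 would be the scalar [eps(p) 1], and the counit kills primitives. *)
Lemma basis_degree_gt0 p : P p -> (0 < degree G p)%N.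
Proof.
move=> Pp; rewrite lt0n; apply: contra (basis_neq0 Pp) => /eqP d0.
have := basis_piece Pp; rewrite d0 => /piece0_scalar ->.
by rewrite (counit_prim (basis_prim Pp)) scale0r.
Qed.

Section Eigen.
Variables (q : K) (j k : nat) (c : j.-tuple H) (p : k.-tuple H).
Hypotheses (hc : {in c, forall x, deg_eq1 G P x}).
Hypotheses (hp : {in p, forall x, deg_gt1 G P x}).

Lemma id_Proj1_sym_prod y : id_Proj1 (sym_prod p * y) = sym_prod p * id_Proj1 y.
Proof.
rewrite /sym_prod !mulr_suml lin_sum; last exact: id_Proj1_linear.
apply: eq_bigr => s _; move: y.
apply: (big_ind (fun z => forall y, id_Proj1 (z * y) = z * id_Proj1 y)).
- by move=> y; rewrite !mul1r.
- by move=> u v IHu IHv y; rewrite -!mulrA IHu IHv.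
move=> b _ y; have [Pb d1] := hp (mem_tnth (s b) p).
exact: id_Proj1_deg_gt1 d1 (basis_prim Pb) (basis_piece Pb).
Qed.

Lemma Proj1_id_sym_prod y : Proj1_id (y * sym_prod p) = Proj1_id y * sym_prod p.
Proof.
rewrite /sym_prod !mulr_sumr lin_sum; last exact: Proj1_id_linear.
apply: eq_bigr => s _; move: y.
apply: (big_ind (fun z => forall y, Proj1_id (y * z) = Proj1_id y * z)).
- by move=> y; rewrite !mulr1.
- by move=> u v IHu IHv y; rewrite !mulrA IHv IHu.
move=> b _ y; have [Pb d1] := hp (mem_tnth (s b) p).
exact: Proj1_id_deg_gt1 d1 (basis_prim Pb) (basis_piece Pb).
Qed.

Lemma eigenvec_eigen n : shuffle_op h G q n (eigenvec q c p) =
  (j%:R / n%:R) *: eigenvec q c p.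
Proof.
rewrite shuffle_opE mulrC -scalerA; congr (_ *: _); rewrite eigenvecE.
have lL := Proj1_id_linear; have lR := id_Proj1_linear.
apply: (sum_binom_op _ lL lR) => i le_ij.
  apply: op_front_sym => //; first exact: Proj1_id1.
    move=> x /hc[Px d1] y; apply: Proj1_id_deg1; first exact: basis_prim.
    by rewrite -d1; exact: basis_piece.
  exact: Proj1_id_sym_prod.
apply: op_back_sym => //; first exact: id_Proj11.
  move=> x /hc[Px d1] y; apply: id_Proj1_deg1; first exact: basis_prim.
  by rewrite -d1; exact: basis_piece.
exact: id_Proj1_sym_prod.
Qed.

End Eigen.

End Graded.

(** * Linear independence *)

Lemma lin_indep_ord (K : fieldType) (V : lmodType K) (A : set V) (s : seq V)
    (u : 'I_(size s) -> K) :
  lin_indep A -> uniq s -> {in s, forall v, A v} ->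
  \sum_i u i *: s`_i = 0 -> forall i, u i = 0.
Proof.
move=> iA us sA; pose a v := oapp u 0 (insub (index v s)).
have Ea (i : 'I_(size s)) : a s`_i = u i by rewrite /a index_uniq // valK.
move=> su i; rewrite -Ea; apply: (iA s a us sA); last exact: mem_nth.
by rewrite (big_nth 0) big_mkord -[RHS]su; apply: eq_bigr => l _; rewrite Ea.
Qed.

Lemma coordinates (K : fieldType) (V : lmodType K) (U : set V) d :
  has_dim U d ->
  exists psi : 'rV[K]_d -> V,
    [/\ linear psi, injective psi & forall x, U x -> exists r, psi r = x].
Proof.
move=> [s [us <- [_ is_ Us]]].
pose psi (r : 'rV[K]_(size s)) := \sum_i r 0 i *: s`_i.
have lpsi : linear psi.
  move=> c r r'; rewrite scaler_sumr -big_split; apply: eq_bigr => i _ /=.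
  by rewrite !mxE scalerDl scalerA.
exists psi; split=> // [r r' e|x /Us].
  apply/rowP => i; apply/eqP; rewrite -subr_eq0; apply/eqP.
  have := lin_indep_ord (u := fun i => (r - r') 0 i) is_ us (fun v => id).
  rewrite -/(psi (r - r')) linB // e subrr => /(_ erefl i).
  by rewrite !mxE.
move: x; apply: (span_ind (U := fun x => exists r, psi r = x)) => [|c x y xs [r <-]].
  by exists 0; rewrite lin0.
have lt_xs : (index x s < size s)%N by rewrite index_mem.
exists (c *: delta_mx 0 (Ordinal lt_xs) + r); rewrite lpsi; congr (_ *: _ + _).
rewrite /psi (bigD1 (Ordinal lt_xs)) //= big1 => [|i ne_i].
  by rewrite mxE !eqxx scale1r addr0 nth_index.
by rewrite mxE (negbTE ne_i) andbF scale0r.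
Qed.

(** * Linear forms dual to elements of the basis of primitives *)

Section Dual.
Variables (K : realFieldType) (H : algType K) (h : hopf_algebra H).
Variables (G : grading H) (hG : graded_connected_hopf h G).
Variables (P : set H) (hP : graded_basis G P (primitive h)).

(** In the degree [d] of [p], the coordinates of the members of [t] of degree [d] are the rows of a
    row-free matrix [A]; [f] projects to H_d, takes coordinates and multiplies by the column for [p]
    of the right inverse of [A]. As [d > 0], [f] kills 1. *)
Lemma dual_functional (t : seq H) p : uniq t -> {in t, forall x, P x} ->
  p \in t ->
  exists f : H -> K, [/\ linear (f : H -> K^o), f 1 = 0 &
    {in t, forall x, f x = (x == p)%:R}].
Proof.
move=> ut tP pt; set d := degree G p.
have [N dimN] := hopf_finite_dim hG d.
have [psi [lpsi ipsi spsi]] := coordinates dimN.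
pose phi x := sval (cid (spsi _ (Proj_in G d x))).
have phiE x : psi (phi x) = Proj G d x := svalP (cid (spsi _ (Proj_in G d x))).
have lphi : linear phi.
  by move=> c x y; apply: ipsi; rewrite lpsi !phiE linearP.
pose t' := [seq x <- t | degree G x == d].
have ut' : uniq t' by exact: filter_uniq.
have t'P : {in t', forall x, P x /\ degree G x = d}.
  by move=> x; rewrite mem_filter => /andP[/eqP ? /tP].
pose A := \matrix_(i < size t') phi t'`_i.
have freeA : row_free A.
  apply/inj_row_free => u uA.
  have /lin_indep_ord : lin_indep P by case: hP => [[]].
  move=> /(_ _ (fun i => u 0 i) ut' (fun x xt => (t'P x xt).1)) h0.
  apply/rowP => i; rewrite mxE; apply: h0.
  rewrite -[RHS](lin0 lpsi) -uA mulmx_sum_row lin_sum //.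
  apply: eq_bigr => l _; rewrite linZ // rowK phiE; congr (_ *: _).
  have [Pl dl] := t'P _ (mem_nth 0 (ltn_ord l)).
  by rewrite Proj_id // -dl; exact: (basis_piece hP).
have pt' : p \in t' by rewrite mem_filter eqxx.
have lt_p : (index p t' < size t')%N by rewrite index_mem.
pose f x := (phi x *m pinvmx A) 0 (Ordinal lt_p).
have phi0 x e : e != d -> G e x -> phi x = 0.
  move=> ne_ed Gx; apply: ipsi; rewrite phiE lin0 //.
  exact: Proj_eq0 Gx.
exists f; split.
- by move=> c x y; rewrite /f lphi mulmxDl -scalemxAl !mxE.
- rewrite /f (phi0 1 0%N) ?mul0mx ?mxE //; last exact: graded_one (hopf_graded hG).
  by rewrite eq_sym -lt0n; apply: (basis_degree_gt0 hG hP); exact: tP.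
move=> x xt; have Px := tP x xt.
case: (eqVneq (degree G x) d) => [dx|ne_dx]; last first.
  rewrite /f (phi0 x (degree G x)) ?mul0mx ?mxE //; last exact: (basis_piece hP).
  by have /negbTE -> : x != p by apply: contraNneq ne_dx => ->.
have xt' : x \in t' by rewrite mem_filter dx eqxx.
have lt_x : (index x t' < size t')%N by rewrite index_mem.
rewrite /f; have -> : (phi x *m pinvmx A) 0 (Ordinal lt_p) = (A *m pinvmx A)
    (Ordinal lt_x) (Ordinal lt_p).
  have <- : row (Ordinal lt_x) A = phi x by rewrite rowK nth_index.
  by rewrite -row_mul mxE.
rewrite mulmxVp // mxE -val_eqE /=; congr (nat_of_bool _)%:R.
apply/eqP/eqP => [e|-> //].
by rewrite -(nth_index 0 xt') e nth_index.
Qed.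

End Dual.

(** * Filtration by word length, and contraction by linear forms *)

Section Filtration.
Variables (K : realFieldType) (H : algType K) (h : hopf_algebra H).
Variables (P : set H) (hP : is_basis P (primitive h)).
Implicit Types (x y : H) (s t : seq H).

Local Notation word s := (\prod_(y <- s) y).

(* Off by one: filt 0 = 0, filt 1 consists of the scalars, and words of length
   m lie in filt m.+1. *)
Definition filt (m : nat) : set H :=
  span [set x | exists s, [/\ {in s, forall y, P y}, (size s < m)%N & x = word s]].

Lemma filt_mono m n x : (m <= n)%N -> filt m x -> filt n x.
Proof.
move=> le_mn; apply: span_mono => _ [s [Ps lt_sm ->]].
by exists s; split=> //; exact: leq_trans le_mn.
Qed.

Lemma filt0 x : filt 0 x -> x = 0.
Proof. by move: x; apply: (span_ind (U := fun x => x = 0)) => // c y z [s []]. Qed.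

Lemma filt_word m s : {in s, forall y, P y} -> (size s < m)%N -> filt m (word s).
Proof. by move=> Ps lt_sm; apply: Defs.sub_span; exists s. Qed.

(** The off-by-one index: fewer than [a] letters times fewer than [b] letters gives at most
    [a + b - 2] letters, hence fewer than [m]. *)
Lemma filtM a b m x y : (a + b <= m.+1)%N ->
  filt a x -> filt b y -> filt m (x * y).
Proof.
move=> le_ab Fx Fy; have [ml mr] := mul_bilin H.
move: x Fx; apply: (span_lin (f := fun x => x * y)) => [|_ [s [Ps lt_sa ->]]].
  exact: ml.
move: y Fy; apply: (span_lin (f := fun y => word s * y)) => [|_ [t [Pt lt_tb ->]]].
  exact: mr.
rewrite -big_cat; apply: filt_word => [z|].
  by rewrite mem_cat => /orP[/Ps|/Pt].
have := leq_trans (leq_add lt_sa lt_tb) le_ab.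
by rewrite addSn addnS size_cat !ltnS.
Qed.

Lemma filt_prim x : primitive h x -> filt 2 x.
Proof.
have [_ _ Ps] := hP => /Ps; apply: span_mono => y Py.
exists [:: y]; split=> //; last by rewrite big_seq1.
by move=> z; rewrite inE => /eqP ->.
Qed.

Lemma filt_basis x : P x -> filt 2 x.
Proof. by have [PP _ _] := hP => /PP; exact: filt_prim. Qed.

Lemma filtMl m x y : P x -> filt m y -> filt m.+1 (x * y).
Proof. by move=> /filt_basis; exact: (@filtM 2 m). Qed.

(** By the Leibniz rule [[x, y w] = [x, y] w + y [x, w]], where [[x, y]] is primitive and so counts
    as one letter instead of two. *)
Lemma filt_comm x s : P x -> {in s, forall y, P y} ->
  filt (size s).+1 (x * word s - word s * x).
Proof.
move=> Px; elim: s => [|y s IH] Ps.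
  by rewrite big_nil mulr1 mul1r subrr; exact: span0.
have Py : P y by apply: Ps; rewrite mem_head.
have {}Ps : {in s, forall y, P y} by move=> z zs; apply: Ps; rewrite inE zs orbT.
have [PP _ _] := hP.
rewrite big_cons /=; have -> : x * (y * word s) - y * word s * x =
    (x * y - y * x) * word s + y * (x * word s - word s * x).
  by rewrite mulrBl mulrBr !mulrA addrA subrK.
apply: spanD; last by apply: filtMl => //; exact: IH.
apply: (@filtM 2 (size s).+1) => //; last exact: filt_word.
by apply/filt_prim/primitive_comm; exact: PP.
Qed.

(** The first letter of [s] is pulled to the front of [t] at the cost of a commutator, which
    [filt_comm] places one step lower. *)
Lemma filt_perm s t : {in s, forall y, P y} -> perm_eq s t ->
  filt (size s) (word s - word t).
Proof.
elim: s t => [|x s IH] t Ps st.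
  have /perm_nilP -> : perm_eq t [::] by rewrite perm_sym.
  by rewrite subrr; exact: span0.
have Px : P x by apply: Ps; rewrite mem_head.
have {}Ps : {in s, forall y, P y} by move=> z zs; apply: Ps; rewrite inE zs orbT.
have xt : x \in t by rewrite -(perm_mem st) mem_head.
case/splitPr: xt st => t1 t2.
rewrite perm_sym -[x :: t2]cat1s perm_catCA /= perm_cons perm_sym => st.
have Pt : {in t1 ++ t2, forall y, P y}.
  by move=> z; rewrite -(perm_mem st); exact: Ps.
have -> : word (x :: s) - word (t1 ++ x :: t2) =
    x * (word s - word (t1 ++ t2)) + (x * word t1 - word t1 * x) * word t2.
  by rewrite !big_cat /= !big_cons mulrBl mulrBr !mulrA addrA subrK.
apply: spanD; first by apply: filtMl => //; exact: IH.
apply: (@filtM (size t1).+1 (size t2).+1).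
- by rewrite /= (perm_size st) size_cat addSn addnS.
- by apply: filt_comm => // z z1; apply: Pt; rewrite mem_cat z1.
- by apply: filt_word => // z z2; apply: Pt; rewrite mem_cat z2 orbT.
Qed.

(** The map [(f ⊗ id) Delta]; for [f] dual to a letter it acts to leading order as a partial
    derivative. *)
Definition contract (f : H -> K) (x : H) : H := cosum h (fun a b => f a *: b) x.

Lemma contract_bilin (f : H -> K) : linear (f : H -> K^o) ->
  is_bilin (fun a b : H => f a *: b).
Proof.
move=> lf; split=> [b|a] c u v; first by rewrite lf scalerDl scalerA.
by rewrite scalerDr !scalerA mulrC.
Qed.

Lemma contract_linear (f : H -> K) : linear (f : H -> K^o) -> linear (contract f).
Proof. by move=> lf; apply/cosum_linear/contract_bilin. Qed.

Lemma contract_mul (f : H -> K) x y : linear (f : H -> K^o) -> P x ->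
  contract f (x * y) = contract (fun a => f (x * a)) y + x * contract f y.
Proof.
move=> lf Px; have [ml mr] := mul_bilin H; have [PP _ _] := hP.
rewrite /contract cosum_priml; [|exact: contract_bilin|exact: PP].
rewrite cosumD (lin_cosum _ _ _ (mr x)); congr (_ + _).
by apply: eq_cosum => a b; rewrite scalerAr.
Qed.

(** In the coproduct of a word only the tensor of 1 with the word has a right factor of full length.
    The induction varies [f], since peeling off [x] replaces it by [f (x * _)]. *)
Lemma contract_word (f : H -> K) s : linear (f : H -> K^o) ->
  {in s, forall y, P y} ->
  filt (size s) (contract f (word s) - f 1 *: word s).
Proof.
elim: s f => [|x s IH] f lf Ps.
  rewrite big_nil /contract cosum1 ?subrr; first exact: span0.
  exact: contract_bilin.
have Px : P x by apply: Ps; rewrite mem_head.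
have {}Ps : {in s, forall y, P y} by move=> z zs; apply: Ps; rewrite inE zs orbT.
have lg : linear ((fun a => f (x * a)) : H -> K^o).
  by move=> c u v; rewrite mulrDr -scalerAr lf.
rewrite big_cons contract_mul // scalerAr -addrA -mulrBr; apply: spanD.
  rewrite -(subrK (f (x * 1) *: word s) (contract _ _)); apply: spanD.
    exact: filt_mono (IH _ lg Ps).
  by apply: spanZ; exact: filt_word.
by apply: filtMl => //; exact: IH.
Qed.

Lemma contract_filt (f : H -> K) m x : linear (f : H -> K^o) -> f 1 = 0 ->
  filt m.+1 x -> filt m (contract f x).
Proof.
move=> lf f1; move: x; apply: span_lin => [|_ [s [Ps lt_sm ->]]].
  exact: contract_linear.
apply: (@filt_mono (size s)) => //.
by have := contract_word lf Ps; rewrite f1 scale0r subr0.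
Qed.

(** Contracting the first letter [x] leaves [f x] times the remaining word; the other terms keep
    [x]. If [x = p], the words [p :: rem p s] and [s] agree modulo lower terms by [filt_perm], so
    the two contributions combine. *)
Lemma contract_count (f : H -> K) p s : linear (f : H -> K^o) -> f 1 = 0 ->
  {in s, forall y, P y} -> {in s, forall x, f x = (x == p)%:R} ->
  filt (size s).-1
    (contract f (word s) - (count_mem p s)%:R *: word (rem p s)).
Proof.
move=> lf f1; elim: s => [|x s IH] Ps fs.
  rewrite big_nil /contract cosum1; last exact: contract_bilin.
  by rewrite f1 !scale0r subrr; exact: span0.
have Px : P x by apply: Ps; rewrite mem_head.
have fx : f x = (x == p)%:R by apply: fs; rewrite mem_head.
have {}Ps : {in s, forall y, P y} by move=> z zs; apply: Ps; rewrite inE zs orbT.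
have {}fs : {in s, forall y, f y = (y == p)%:R}.
  by move=> z zs; apply: fs; rewrite inE zs orbT.
have lg : linear ((fun a => f (x * a)) : H -> K^o).
  by move=> c u v; rewrite mulrDr -scalerAr lf.
(* For empty [s] the truncated predecessor is harmless because [filt P 0] is zero. *)
have Fx z : filt (size s).-1 z -> filt (size s) (x * z).
  case: (size s) => [|n] Fz; first by rewrite (filt0 Fz) mulr0; exact: span0.
  exact: filtMl.
have F1 := contract_word lg Ps; rewrite mulr1 fx in F1.
have {Fx IH}F2 := Fx _ (IH Ps fs).
rewrite big_cons contract_mul //=.
case: (eqVneq x p) F1 F2 => [xp|ne_xp] F1; rewrite ?add0n => F2.
  rewrite natrD scalerDl opprD addrACA; apply: spanD => //.
  have -> : x * contract f (word s) - (count_mem p s)%:R *: word s =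
      x * (contract f (word s) - (count_mem p s)%:R *: word (rem p s)) +
      (count_mem p s)%:R *: (word (p :: rem p s) - word s).
    by rewrite mulrBr big_cons scalerBr -scalerAr xp addrA subrK.
  apply: spanD => //.
  case: (boolP (p \in s)) => [ps|/count_memPn ->]; last first.
    by rewrite scale0r; exact: span0.
  apply: spanZ; have spr := perm_to_rem ps; rewrite (perm_size spr).
  apply: filt_perm; last by rewrite perm_sym.
  by move=> z; rewrite -(perm_mem spr); exact: Ps.
rewrite scale0r subr0 in F1.
rewrite big_cons scalerAr -addrA; apply: spanD => //.
by rewrite -mulrBr.
Qed.

End Filtration.

(** * Eigenvectors as sums of words *)

Section Eigenvec.
Variables (K : realFieldType) (H : algType K).
Implicit Types (s t : seq H) (q : K).

Local Notation word s := (\prod_(y <- s) y).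

Lemma sym_prodE k (p : k.-tuple H) : sym_prod p = \sum_(t : 'S_k) word (permute p t).
Proof.
apply: eq_bigr => t _; rewrite big_map enumT.
by rewrite [index_enum _]unlock.
Qed.

Lemma eigenvec_words q j k (c : j.-tuple H) (p : k.-tuple H) :
  eigenvec q c p = \sum_(i < j.+1)
    ('C(j, i)%:R * q ^+ i * (1 - q) ^+ (j - i)) *:
      \sum_(s : 'S_j) \sum_(t : 'S_k)
        word (take i (permute c s) ++ permute p t ++ drop i (permute c s)).
Proof.
rewrite eigenvecE; apply: eq_bigr => i _; congr (_ *: _); apply: eq_bigr => s _.
rewrite /sandwich sym_prodE mulr_sumr mulr_suml; apply: eq_bigr => t _.
by rewrite !big_cat /= mulrA.
Qed.

Lemma perm_eigen_word j k (c : j.-tuple H) (p : k.-tuple H) i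
    (s : 'S_j) (t : 'S_k) :
  perm_eq (take i (permute c s) ++ permute p t ++ drop i (permute c s)) (c ++ p).
Proof.
apply: (@perm_trans _ (permute c s ++ permute p t)).
  by rewrite -{3}(cat_take_drop i (permute c s)) -catA perm_cat2l perm_catC.
by apply: perm_cat; exact: perm_permute.
Qed.

(** The binomial theorem for [q + (1 - q)]; it makes the leading coefficient of the eigenvectors
    independent of [q]. *)
Lemma sum_binom_coef q j :
  \sum_(i < j.+1) 'C(j, i)%:R * q ^+ i * (1 - q) ^+ (j - i) = 1.
Proof.
rewrite -[RHS](expr1n _ j) -[X in _ = X ^+ j](subrK q) exprDn.
by apply: eq_bigr => i _; rewrite -mulr_natl; ring.
Qed.

Lemma sym_sandwich_perm j (c c' : j.-tuple H) Z i : perm_eq c c' ->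
  sym_sandwich c Z i = sym_sandwich c' Z i.
Proof.
move=> /tuple_permP[u Eu]; rewrite /sym_sandwich [RHS](reindex_inj (mulIg u)).
apply: eq_bigr => s _; congr sandwich; apply: eq_map => a.
have -> : c = [tuple tnth c' (u i) | i < j] by apply: val_inj.
by rewrite tnth_mktuple permM.
Qed.

Lemma sym_prod_perm k (p p' : k.-tuple H) : perm_eq p p' ->
  sym_prod p = sym_prod p'.
Proof.
(* [sym_prod p] is [sym_sandwich p 1 0], so the preceding invariance applies. *)
move=> pp; have := sym_sandwich_perm 1 0 pp; rewrite /sym_sandwich !sym_prodE.
under eq_bigr => s _ do rewrite sandwich0 mul1r.
by under [in X in _ = X -> _]eq_bigr => s _ do rewrite sandwich0 mul1r.
Qed.

Lemma eigenvec_perm q j k (c c' : j.-tuple H) (p p' : k.-tuple H) :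
  perm_eq c c' -> perm_eq p p' -> eigenvec q c p = eigenvec q c' p'.
Proof.
move=> cc pp; rewrite !eigenvecE (sym_prod_perm pp).
by apply: eq_bigr => i _; rewrite (sym_sandwich_perm _ _ cc).
Qed.

End Eigenvec.

(** * Independence from leading words *)

Section Independence.
Variables (K : realFieldType) (H : algType K) (h : hopf_algebra H).
Variables (G : grading H) (hG : graded_connected_hopf h G).
Variables (P : set H) (hP : graded_basis G P (primitive h)).
Implicit Types (s t : seq H) (q : K).

Local Notation word s := (\prod_(y <- s) y).

Let bP : is_basis P (primitive h) := hP.1.

(** Contraction by a form dual to a letter [p] of [w i] gives a relation one letter shorter, with
    coefficients multiplied by the multiplicity of [p]; as that in [w i] is nonzero in
    characteristic 0, [a i] vanishes. At length 0 all words are empty, so [r] has only one index. *)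
Lemma word_indep (I : eqType) m (w : I -> seq H) (r : seq I) (a : I -> K) :
  uniq r -> {in r &, forall i j, perm_eq (w i) (w j) -> i = j} ->
  {in r, forall i, size (w i) = m} ->
  {in r, forall i, {in w i, forall y, P y}} ->
  filt P m (\sum_(i <- r) a i *: word (w i)) -> {in r, forall i, a i = 0}.
Proof.
elim: m w r a => [|m IH] w r a ur dw sw Pw Fw i ir.
  have w0 l : l \in r -> w l = [::] by move/sw/size0nil.
  have rest : \sum_(l <- r | l != i) a l *: word (w l) = 0.
    apply: big1_seq => l /andP[/negP ne_li lr]; case: ne_li; apply/eqP/dw => //.
    by rewrite !w0.
  move/filt0/eqP: Fw; rewrite (bigD1_seq i) //= rest w0 // big_nil addr0.
  by rewrite scaler_eq0 oner_eq0 orbF => /eqP.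
have [p pi] : exists p, p \in w i.
  by case: (w i) (sw i ir) => // p s _; exists p; rewrite mem_head.
pose t := undup (flatten [seq w l | l <- r]).
have tw l x : l \in r -> x \in w l -> x \in t.
  by move=> lr xl; rewrite mem_undup; apply/flattenP; exists (w l); rewrite ?map_f.
have tP : {in t, forall x, P x}.
  move=> x; rewrite mem_undup => /flattenP[_ /mapP[l lr ->]]; exact: Pw.
have [f [lf f1 ft]] := dual_functional hG hP (undup_uniq _) tP (tw _ _ ir pi).
pose b l := a l * (count_mem p (w l))%:R.
(* Words without [p] are dropped: their coefficient [b l] is 0, but [rem] would not shorten them,
   and the induction needs equal lengths. *)
pose r' := [seq l <- r | p \in w l].
have r'r l : l \in r' -> p \in w l /\ l \in r.
  by rewrite mem_filter => /andP[].
have ir' : i \in r' by rewrite mem_filter pi.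
have : b i = 0.
  apply: (IH (fun l => rem p (w l)) r') ir'.
  - exact: filter_uniq.
  - move=> l l' /r'r[pl lr] /r'r[pl' lr'] e; apply: dw => //.
    rewrite (permPl (perm_to_rem pl)) (permPr (perm_to_rem pl')).
    by rewrite perm_cons.
  - by move=> l /r'r[pl lr]; rewrite size_rem // sw.
  - by move=> l /r'r[pl lr] y /mem_rem; exact: Pw.
  have lF := contract_linear h lf.
  rewrite big_filter; have -> : \sum_(l <- r | p \in w l) b l *: word (rem p (w l)) =
      \sum_(l <- r) b l *: word (rem p (w l)).
    rewrite big_mkcond; apply: eq_bigr => l _; case: ifP => // /negbT/count_memPn e.
    by rewrite /b e mulr0 scale0r.
  rewrite -[X in filt _ _ X](subKr (contract h f (\sum_(l <- r) a l *: word (w l)))).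
  apply: spanB; first exact: (contract_filt bP lf f1 Fw).
  rewrite lin_sum // -sumrB; apply: span_sum => l lr _.
  rewrite linZ // /b -scalerA -scalerBr; apply: spanZ.
  have -> : m = (size (w l)).-1 by rewrite sw.
  by apply: contract_count => // x; [exact: Pw | move/(tw _ _ lr); exact: ft].
move/eqP; rewrite mulf_eq0 pnatr_eq0 => /orP[/eqP //|].
by rewrite -leqn0 leqNgt -has_count has_pred1 pi.
Qed.

(** A triangularity argument: modulo shorter words a relation involves only the longest leading
    words, whose coefficients vanish by [word_indep]; what remains has a smaller length bound
    [N]. *)
Lemma leading_indep (I : eqType) (v : I -> H) (w : I -> seq H) (k : I -> K)
    (r : seq I) (a : I -> K) :
  uniq r -> {in r &, forall i j, perm_eq (w i) (w j) -> i = j} ->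
  {in r, forall i, {in w i, forall y, P y}} ->
  {in r, forall i, k i != 0} ->
  {in r, forall i, filt P (size (w i)) (v i - k i *: word (w i))} ->
  \sum_(i <- r) a i *: v i = 0 -> {in r, forall i, a i = 0}.
Proof.
move=> + + + + +.
have [N] : exists N, {in r, forall i, (size (w i) < N)%N}.
  exists (\max_(i <- r) size (w i)).+1 => i ir; rewrite ltnS.
  exact: (leq_bigmax_seq _ ir).
elim: N r => [|N IH] r sN ur dw Pw k0 Fw v0 i ir; first by have := sN i ir.
have top : {in [seq l <- r | size (w l) == N], forall l, a l * k l = 0}.
  have rr l : l \in [seq l <- r | size (w l) == N] -> size (w l) = N /\ l \in r.
    by rewrite mem_filter => /andP[/eqP].
  apply: (word_indep (m := N) (w := w)).
  - exact: filter_uniq.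
  - by move=> l l' /rr[_ lr] /rr[_ lr']; exact: dw.
  - by move=> l /rr[].
  - by move=> l /rr[_ lr]; exact: Pw.
  rewrite big_filter -[X in filt _ _ X](subKr (\sum_(l <- r) a l *: v l)).
  apply: spanB; first by rewrite v0; exact: span0.
  rewrite (bigID (fun l => size (w l) == N)) /= addrAC -sumrB.
  apply: spanD; apply: span_sum => l lr.
    move=> /eqP <-; rewrite -scalerA -scalerBr; apply: spanZ; exact: Fw.
  move=> ne_l; have lt_l : (size (w l) < N)%N.
    by rewrite ltn_neqAle ne_l -ltnS sN.
  apply: spanZ; rewrite -(subrK (k l *: word (w l)) (v l)); apply: spanD.
    exact: filt_mono (ltnW lt_l) (Fw l lr).
  by apply/spanZ/filt_word => //; exact: Pw.
have a0 l : l \in r -> size (w l) = N -> a l = 0.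
  move=> lr sl; have : a l * k l = 0 by apply: top; rewrite mem_filter sl eqxx.
  by move/eqP; rewrite mulf_eq0 (negbTE (k0 l lr)) orbF => /eqP.
case: (eqVneq (size (w i)) N) => [|ne_i]; first exact: a0.
have rr l : l \in [seq l <- r | size (w l) != N] -> size (w l) != N /\ l \in r.
  by rewrite mem_filter => /andP[].
apply: (IH [seq l <- r | size (w l) != N]); last by rewrite mem_filter ne_i.
- by move=> l /rr[ne_l lr]; rewrite ltn_neqAle ne_l -ltnS sN.
- exact: filter_uniq.
- by move=> l l' /rr[_ lr] /rr[_ lr']; exact: dw.
- by move=> l /rr[_ lr]; exact: Pw.
- by move=> l /rr[_ lr]; exact: k0.
- by move=> l /rr[_ lr]; exact: Fw.
rewrite big_filter big_mkcond -[RHS]v0 big_seq [RHS]big_seq.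
apply: eq_bigr => l lr; case: ifPn => // /negPn/eqP /(a0 _ lr) ->.
by rewrite scale0r.
Qed.

(** For each [i] the eigenvector sums [j! k!] words, all rearrangements of [c ++ p] and so equal to
    it modulo lower terms by [filt_perm]; the binomial weights add up to 1. *)
Lemma eigenvec_leading q j k (c : j.-tuple H) (p : k.-tuple H) :
  {in c, forall x, P x} -> {in p, forall x, P x} ->
  filt P (j + k) (eigenvec q c p - (j`! * k`!)%:R *: word (c ++ p)).
Proof.
move=> Pc Pp.
have Pcp : {in c ++ p, forall x, P x} by move=> x; rewrite mem_cat => /orP[/Pc|/Pp].
have scp : size (c ++ p) = (j + k)%N by rewrite size_cat !size_tuple.
set N : K := (j`! * k`!)%:R.
rewrite -[X in _ - X]scale1r -(sum_binom_coef q j) scaler_suml eigenvec_words -sumrB.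
apply: span_sum => i _ _; rewrite -scalerBr; apply: spanZ.
have -> : N *: word (c ++ p) =
    \sum_(s : 'S_j) \sum_(t : 'S_k) word (c ++ p).
  by rewrite /N !sumr_const !card_Sn -mulrnA scaler_nat mulnC.
rewrite -sumrB; apply: span_sum => s _ _; rewrite -sumrB; apply: span_sum => t _ _.
rewrite -opprB -scaleN1r; apply: spanZ; rewrite -scp; apply: (filt_perm bP) => //.
by rewrite perm_sym; exact: perm_eigen_word.
Qed.

(** Stated for the union over all [j], it yields both the independence of each set and that of the
    final basis. The leading word [c ++ p] determines both multisets because degree 1 separates the
    letters of [c] from those of [p]. *)
Lemma eigensets_indep q n : lin_indep (\bigcup_j eigenset G P q n j).
Proof.
move=> s a us sE.
have /choice[w hw] : forall v, exists w : seq H * K, v \in s ->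
    exists j k (c : j.-tuple H) (p : k.-tuple H),
      [/\ {in c, forall x, deg_eq1 G P x}, {in p, forall x, deg_gt1 G P x},
          v = eigenvec q c p & w = ((c ++ p : seq H), (j`! * k`!)%:R)].
  move=> v; case: (boolP (v \in s)) => [vs|_]; last by exists ([::], 0).
  have [j _ [k [c [p [hc hp _ ->]]]]] := sE v vs.
  by eexists; exists j, k, c, p; split.
apply: (leading_indep (w := fun v => (w v).1) (k := fun v => (w v).2)) => //.
- move=> u v /hw[j [k [c [p [hc hp -> ->]]]]].
  case/hw=> [j' [k' [c' [p' [hc' hp' -> ->]]]]] /= e.
  have f1 m l (b : m.-tuple H) (d : l.-tuple H) :
      {in b, forall x, deg_eq1 G P x} -> {in d, forall x, deg_gt1 G P x} ->
      [seq x <- b ++ d | degree G x == 1%N] = b /\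
      [seq x <- b ++ d | degree G x != 1%N] = d.
    move=> hb hd; rewrite !filter_cat.
    have /all_filterP -> : all (fun x => degree G x == 1%N) b.
      by apply/allP => x /hb[_ /eqP].
    have /all_filterP -> : all (fun x => degree G x != 1%N) d.
      by apply/allP => x /hd[_]; rewrite ltn_neqAle eq_sym => /andP[].
    split; rewrite (eq_in_filter (a2 := pred0)) ?filter_pred0 ?cats0 //.
      by move=> x /hd[_]; rewrite ltn_neqAle eq_sym => /andP[/negbTE].
    by move=> x /hb[_ ->].
  have ec : perm_eq c c'.
    rewrite -(f1 _ _ _ _ hc hp).1 -(f1 _ _ _ _ hc' hp').1.
    exact: perm_filter.
  have ep : perm_eq p p'.
    rewrite -(f1 _ _ _ _ hc hp).2 -(f1 _ _ _ _ hc' hp').2.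
    exact: perm_filter.
  have ej : j = j' by have := perm_size ec; rewrite !size_tuple.
  have ek : k = k' by have := perm_size ep; rewrite !size_tuple.
  by subst j' k'; exact: eigenvec_perm.
- move=> v /hw[j [k [c [p [hc hp _ ->]]]]] x /=.
  by rewrite mem_cat => /orP[/hc[]|/hp[]].
- move=> v /hw[j [k [c [p [_ _ _ ->]]]]] /=.
  by rewrite pnatr_eq0 -lt0n muln_gt0 !fact_gt0.
move=> v /hw[j [k [c [p [hc hp -> ->]]]]] /=.
rewrite size_cat !size_tuple; apply: eigenvec_leading => x; first by case/hc.
by case/hp.
Qed.

End Independence.

(** * Generation by primitives in the cocommutative case *)

Section Cocommutative.
Variables (K : realFieldType) (H : algType K) (h : hopf_algebra H).
Variables (G : grading H) (hG : graded_connected_hopf h G).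

Lemma piece_ext x y : (forall e, Proj G e x = Proj G e y) -> x = y.
Proof.
move=> exy; apply/eqP; rewrite -subr_eq0; apply/eqP.
have [N ->] := Proj_sum G (x - y); apply: big1 => e _.
by rewrite linearB /= exy subrr.
Qed.

(** The sum defining [D x] has a bound depending on [x], so linearity is checked on homogeneous
    components. *)
Lemma degree_operator : exists D : H -> H,
  linear D /\ forall n x, G n x -> D x = n%:R *: x.
Proof.
pose N x := sval (cid (Proj_sum G x)).
have EN x : x = \sum_(d < N x) Proj G d x := svalP (cid (Proj_sum G x)).
pose D x := \sum_(d < N x) d%:R *: Proj G d x.
have PD e x : Proj G e (D x) = e%:R *: Proj G e x.
  rewrite {2}[x]EN /D !linear_sum; apply: eq_bigr => d _ /=.
  rewrite linearZ /=; case: (eqVneq (d : nat) e) => [-> //|ne_de].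
  by rewrite (Proj_eq0 ne_de (Proj_in G d x)) !scaler0.
exists D; split=> [c x y|n x Gx]; apply: piece_ext => e.
  by rewrite PD !linearP !PD.
rewrite PD linearZ /=; case: (eqVneq n e) => [-> //|ne_ne].
by rewrite (Proj_eq0 ne_ne Gx) !scaler0.
Qed.

Variable D : H -> H.
Hypotheses (lD : linear D) (DE : forall n x, G n x -> D x = n%:R *: x).

Lemma D1 : D 1 = 0.
Proof. by rewrite (DE (graded_one (hopf_graded hG))) scale0r. Qed.

Definition dynkin (x : H) : H := cosum h (fun a b => antipode h a * D b) x.

Lemma dynkin_bilin : is_bilin (fun a b : H => antipode h a * D b).
Proof.
have [ml mr] := mul_bilin H; split=> [b|a] c u v; last by rewrite lD mr.
by rewrite linearP ml.
Qed.

Lemma dynkin_linear : linear dynkin.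
Proof. exact/cosum_linear/dynkin_bilin. Qed.

Lemma dynkin1 : dynkin 1 = 0.
Proof. by rewrite /dynkin cosum1 ?D1 ?mulr0 //; exact: dynkin_bilin. Qed.

Lemma cosum_antipodel x : cosum h (fun a b => antipode h a * b) x = (counit h x)%:A.
Proof. by rewrite -antipodel convolutionE //; exact: linearP. Qed.

Lemma cosum_antipoder x : cosum h (fun a b => a * antipode h b) x = (counit h x)%:A.
Proof. by rewrite -antipoder convolutionE //; exact: linearP. Qed.

(** [id * (S * D) = (id * S) * D = D] by coassociativity and the antipode axiom. *)
Lemma cosum_id_dynkin x : cosum h (fun a b => a * dynkin b) x = D x.
Proof.
have [ml mr] := mul_bilin H.
under eq_cosum => a b do rewrite (lin_cosum _ _ _ (mr a)).
rewrite -cosumA; last first.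
  by split=> ? ? c u v; rewrite ?lD ?linearP ?ml ?mr ?ml ?mr.
rewrite -(cosum_counitl h x lD); apply: eq_cosum => a c.
under eq_cosum => a1 a2 do rewrite mulrA.
rewrite -(lin_cosum _ _ _ (ml (D c))) cosum_antipoder.
by rewrite -scalerAl mul1r.
Qed.

(** [D] is a coderivation because degrees add in a homogeneous tensor. *)
Lemma comul_D x :
  comul h (D x) = cosum h (fun a b => D a ⊗ b) x + cosum h (fun a b => a ⊗ D b) x.
Proof.
have [pl pr] := pure_bilin H H.
have bF : is_bilin (fun a b => D a ⊗ b + a ⊗ D b).
  by split=> [b|a] c u v; rewrite lD !(pl, pr) scalerDr addrACA.
rewrite -cosumD; apply: (lin_piece_ext (f := fun x => comul h (D x))) x.
- by move=> c u v; rewrite lD linearP.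
- exact: cosum_linear.
move=> n x Gx; rewrite (DE Gx) linearZ /= -tensor_lift_comul //.
move: (graded_comul (hopf_graded hG) Gx).
have lF := tensor_lift_lin bF.
apply: (span_ind (U := fun t => n%:R *: t = tensor_lift _ t)).
  by rewrite scaler0 (lin0 lF).
move=> c t t' [i [j [a [b [<- Ga Gb ->]]]]]; rewrite lF => <-.
rewrite tensor_lift_pure // (DE Ga) (DE Gb) (linZ (pl _)) (linZ (pr _)).
by rewrite -scalerDl -natrD scalerDr !scalerA mulrC.
Qed.

Hypothesis cch : cocommutative h.

(* u measures the failure of dynkin to be primitive.  Both Delta * (Delta o d)
   and Delta * (d (x) 1 + 1 (x) d) are Delta o D, so Delta * u = 0; convolving
   with Delta o S, the inverse of Delta, gives u = 0. *)
Lemma dynkin_primitive x : primitive h (dynkin x).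
Proof.
have [pl pr] := pure_bilin H H; have [ml mr] := mul_bilin H.
have [tl tr] := tensor_mul_bilin H; have ld := dynkin_linear.
pose u x := comul h (dynkin x) - dynkin x ⊗ 1 - 1 ⊗ dynkin x.
have lu : linear u.
  move=> c y z; rewrite /u ld linearP /= pl pr.
  by rewrite opprD addrACA -scalerBr opprD addrACA -scalerBr.
have u0 y : cosum h (fun a b => tensor_mul (comul h a) (u b)) y = 0.
  under eq_cosum => a b do rewrite /u !(linB (tr _)) -comul_mul.
  rewrite !cosumB -(lin_cosum h _ y (linearP (comul h))) cosum_id_dynkin.
  have -> : cosum h (fun a b => tensor_mul (comul h a) (dynkin b ⊗ 1)) y =
      cosum h (fun a b => D a ⊗ b) y.
    under eq_cosum => a b.
      rewrite coseqE (lin_sum (tl _)).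
      under eq_bigr => w _ do rewrite tensor_mul_pure mulr1.
      over.
    rewrite (cosumA h (F := fun a1 a2 b => (a1 * dynkin b) ⊗ a2)); last first.
      by split=> ? ? c v w; rewrite ?ld ?ml ?mr ?pl ?pr.
    (* Cocommutativity enters here: it turns the sum of x_(1) d(x_(3)) ⊗ x_(2) into that of x_(1)
       d(x_(2)) ⊗ x_(3), whose left factor collapses to [D]. *)
    under eq_cosum => a b.
      rewrite (cosumC (h := h) (F := fun b1 b2 => (a * dynkin b2) ⊗ b1)) //;
        last first.
        by split=> ? c v w; rewrite ?ld ?ml ?mr ?pl ?pr.
      over.
    rewrite -(cosumA h (F := fun a b1 b2 => (a * dynkin b1) ⊗ b2)); last first.
      by split=> ? ? c v w; rewrite ?ld ?ml ?mr ?pl ?pr.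
    apply: eq_cosum => a b.
    by rewrite -(lin_cosum _ _ _ (pl b)) cosum_id_dynkin.
  have -> : cosum h (fun a b => tensor_mul (comul h a) (1 ⊗ dynkin b)) y =
      cosum h (fun a b => a ⊗ D b) y.
    under eq_cosum => a b.
      rewrite coseqE (lin_sum (tl _)).
      under eq_bigr => w _ do rewrite tensor_mul_pure mulr1.
      over.
    rewrite (cosumA h (F := fun a1 a2 b => a1 ⊗ (a2 * dynkin b))); last first.
      by split=> ? ? c v w; rewrite ?ld ?ml ?mr ?pl ?pr.
    apply: eq_cosum => a b.
    by rewrite -(lin_cosum _ _ _ (pr a)) cosum_id_dynkin.
  by rewrite comul_D addrAC addrK subrr.
suff : u x = 0.
  by rewrite /u -addrA -opprD => /eqP; rewrite subr_eq0 addrC => /eqP.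
rewrite -(cosum_counitl h x lu).
transitivity (cosum h (fun a b => cosum h (fun a1 a2 =>
    tensor_mul (comul h (antipode h a1)) (tensor_mul (comul h a2) (u b))) a) x).
  apply: eq_cosum => a b; under eq_cosum => a1 a2 do rewrite tensor_mulA -comul_mul.
  rewrite -(lin_cosum h _ a (tl (u b))) -(lin_cosum h _ a (linearP (comul h))).
  by rewrite cosum_antipodel linearZ /= comul1 (linZ (tl _)) tensor_mul1.
rewrite (cosumA h (F := fun a1 a2 b =>
    tensor_mul (comul h (antipode h a1)) (tensor_mul (comul h a2) (u b)))).
  rewrite -[RHS](cosum0 h _ x); apply: eq_cosum => a b.
  by rewrite -(lin_cosum h _ b (tr _)) u0 (lin0 (tr _)).
by split=> ? ? c v w; rewrite ?lu ?linearP ?tl ?tr ?tl ?tr.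
Qed.

Variables (P : set H) (hP : graded_basis G P (primitive h)).

Lemma cocommutative_generated x : span [set y | exists2 s : seq H,
  {in s, forall z, P z} & y = \prod_(z <- s) z] x.
Proof.
set A := [set y | _]; have [[_ _ Pspan] _] := hP.
have [ml mr] := mul_bilin H.
have mulA y z : span A y -> primitive h z -> span A (y * z).
  move=> Ay /Pspan; move: z.
  apply: (span_lin (f := fun z => y * z)) => [|z Pz]; first exact: mr.
  move: y Ay; apply: (span_lin (f := fun y => y * z)) => [|_ [s Ps ->]].
    exact: ml.
  apply: Defs.sub_span; exists (rcons s z); last by rewrite prod_rcons.
  by move=> w; rewrite mem_rcons inE => /orP[/eqP ->|/Ps].
have [N ->] := Proj_sum G x; apply: span_sum => d _ _.
elim/ltn_ind: (d : nat) (Proj G d x) (Proj_in G d x) => {d} n IH y Gy.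
case: n IH Gy => [|n] IH Gy.
  rewrite (piece0_scalar hG Gy); apply/spanZ/Defs.sub_span.
  by exists [::]; rewrite ?big_nil.
have -> : y = n.+1%:R^-1 *: D y.
  by rewrite (DE Gy) scalerA mulVf ?scale1r // pnatr_eq0.
apply: spanZ; rewrite -cosum_id_dynkin.
apply: (cosum_piece hG (U := span A) _ _ _ _ Gy).
- by split=> [b|a] c u v; rewrite ?dynkin_linear ?ml ?mr.
- exact: span0.
- exact: spanZD.
(* If [b] has degree 0 then [dynkin b] is 0; otherwise [a] has lower degree than [y] and the
   induction hypothesis applies. *)
move=> i j a b ij Ga Gb; case: j ij Gb => [|j] ij Gb.
  rewrite (piece0_scalar hG Gb) (linZ dynkin_linear) dynkin1 scaler0 mulr0.
  exact: span0.
apply: mulA; last exact: dynkin_primitive.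
by apply: IH Ga; rewrite -ij -addSnnS leq_addr.
Qed.

End Cocommutative.

(** * Spanning of each graded piece by eigenvectors *)

Section Eigenbasis.
Variables (K : realFieldType) (H : algType K) (h : hopf_algebra H).
Variables (G : grading H) (hG : graded_connected_hopf h G).
Variables (P : set H) (hP : graded_basis G P (primitive h)).
Implicit Types (q : K).

(** All words involved are rearrangements of [c ++ p], of degree [j + (n - j)]; for [j <= n] the
    truncated subtraction makes this [n]. *)
Lemma eigenset_piece q n j v : (j <= n)%N -> eigenset G P q n j v -> G n v.
Proof.
move=> le_jn [k [c [p [hc hp dp ->]]]]; rewrite eigenvec_words.
apply: piece_sum => i _ _; apply: pieceZ; apply: piece_sum => s _ _.
apply: piece_sum => t _ _; set w := _ ++ _.
have wcp : perm_eq w (c ++ p) by exact: perm_eigen_word.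
have <- : (\sum_(x <- w) degree G x)%N = n.
  rewrite (perm_big _ wcp) big_cat /= dp -[RHS](subnKC le_jn); congr (_ + _)%N.
  rewrite (eq_big_seq (fun=> 1%N)) ?sum1_size ?size_tuple // => x /hc[_ ->] //.
apply: (piece_prod hG) => x; rewrite (perm_mem wcp) mem_cat => xcp.
by apply: (basis_piece hP); case/orP: xcp => [/hc|/hp] [].
Qed.

(** Induction on the filtration: up to lower terms and the nonzero factor [j! k!], a word is the
    leading term of the eigenvector built from its own letters, separated by degree. *)
Lemma filt_span_eigenvec q m : filt P m `<=`
  span [set v | exists n j, (j <= n)%N /\ eigenset G P q n j v].
Proof.
set A := [set v | _]; elim: m => [|m IH] x.
  by move/filt0 ->; exact: span0.
move: x; apply: span_trans => _ [s [Ps lt_sm ->]].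
pose c := in_tuple [seq x <- s | degree G x == 1%N].
pose p := in_tuple [seq x <- s | degree G x != 1%N].
have hc : {in c, forall x, deg_eq1 G P x}.
  by move=> x; rewrite mem_filter => /andP[/eqP d1 /Ps].
have hp : {in p, forall x, deg_gt1 G P x}.
  move=> x; rewrite mem_filter => /andP[d1 /Ps Px]; split=> //.
  by rewrite ltn_neqAle eq_sym d1 (basis_degree_gt0 hG hP).
have scp : perm_eq s (c ++ p) by rewrite perm_sym perm_filterC.
have Fe := eigenvec_leading hP q (fun x xc => (hc x xc).1)
  (fun x xp => (hp x xp).1).
have Fs := filt_perm hP.1 Ps scp.
rewrite -size_cat -(perm_size scp) in Fe.
set e := eigenvec _ _ _ in Fe; set N : K := (_)%:R in Fe.
have N0 : N != 0 by rewrite pnatr_eq0 -lt0n muln_gt0 !fact_gt0.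
have Fm y : filt P (size s) y -> span A y.
  by move=> Fy; apply: IH; exact: filt_mono Fy.
have -> : \prod_(y <- s) y = (\prod_(y <- s) y - \prod_(y <- c ++ p) y) +
    N^-1 *: (e - (e - N *: \prod_(y <- c ++ p) y)).
  by rewrite subKr scalerA mulVf // scale1r subrK.
apply: spanD; first exact: Fm.
apply: spanZ; apply: spanB; last exact: Fm.
apply: Defs.sub_span; pose d := (\sum_(x <- p) degree G x)%N.
exists (size c + d)%N, (size c); split; first exact: leq_addr.
by exists (size p), c, p; rewrite addKn.
Qed.

(** Letters of [p] have degree at least 2, so [n - j] is either 0 or at least 2; this is why the
    index [n - 1] is absent. *)
Lemma eigenset_index q n j v : (j <= n)%N -> eigenset G P q n j v ->
  (j.+2 <= n)%N \/ j = n.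
Proof.
move=> le_jn [k [c [p [_ hp dp _]]]].
have [p0|] : p = [::] :> seq H \/ exists x, x \in (p : seq H).
  by case: (p : seq H) => [|x s]; [left | right; exists x; rewrite mem_head].
  right; move: dp; rewrite p0 big_nil => /eqP; rewrite eq_sym subn_eq0 => le_nj.
  by apply/eqP; rewrite eqn_leq le_jn.
move=> [x xp]; left; have [_ d1] := hp x xp.
have : (1 < n - j)%N.
  by rewrite -dp (big_rem x xp) /= (leq_trans d1) // leq_addr.
by rewrite ltn_subRL addn1.
Qed.

(** Eigenvectors of all degrees span [H]; projecting to degree [n] kills those of other degrees and
    fixes the rest. *)
Lemma piece_span_eigensets q n x : cocommutative h -> G n x ->
  span (\bigcup_(j in [set j | (j.+2 <= n)%N \/ j = n]) eigenset G P q n j) x.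
Proof.
move=> cch Gx; rewrite -(Proj_id Gx).
have [D [lD DE]] := degree_operator G.
have : span [set v | exists n j, (j <= n)%N /\ eigenset G P q n j v] x.
  have := cocommutative_generated hG lD DE cch hP x.
  apply: span_trans => _ [s Ps ->]; apply: (@filt_span_eigenvec q (size s).+1).
  exact: filt_word.
move: x {Gx}; apply: span_lin => [|v [m [j [le_jm Ev]]]]; first exact: linearP.
have Gv := eigenset_piece le_jm Ev.
case: (eqVneq m n) => [<-|ne_mn]; last first.
  by rewrite (Proj_eq0 ne_mn Gv); exact: span0.
rewrite (Proj_id Gv); apply: Defs.sub_span; exists j => //.
exact: eigenset_index Ev.
Qed.

End Eigenbasis.

Theorem theorem5p1 (K : realFieldType) (H : algType K) (h : hopf_algebra H)
    (G : grading H) (q : K) (P : set H) (n : nat)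
    (hG : graded_connected_hopf h G)
    (hP : graded_basis G P (primitive h))
    (hn : (0 < n)%N) :
  let T := shuffle_op h G q n in
  let E := eigenset G P q n in
  let J := [set j | (j.+2 <= n)%N \/ j = n] in
  [/\ forall x, G n x -> G n (T x),
      forall j, (j <= n)%N ->
        lin_indep (E j) /\
        (forall v, E j v -> eigenvector T (G n) (j%:R / n%:R) v)
    & cocommutative h ->
        trivIset J E /\ is_basis (\bigcup_(j in J) E j) (G n)].
Proof.
move=> T E J; have iE : lin_indep (\bigcup_j E j) by exact: (eigensets_indep hG hP).
have Jn j : J j -> (j <= n)%N by case=> [/ltnW/ltnW //|->].
have eigE j v : (j <= n)%N -> E j v -> eigenvector T (G n) (j%:R / n%:R) v.
  move=> le_jn Ev; split; first exact: (eigenset_piece hG hP le_jn Ev).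
    by apply: (lin_indep_neq0 iE); exists j.
  by case: Ev => k [c [p [hc hp _ ->]]]; exact: (eigenvec_eigen hG hP).
split=> [x|j le_jn|cch].
- exact: (shuffle_op_piece hG).
- split=> [|v]; last exact: eigE.
  by apply: lin_indep_mono iE => v Ev; exists j.
split.
  (* A common element is nonzero with eigenvalues [i / n] and [j / n], which forces [i = j] as
     [n > 0]. *)
  move=> i j /Jn le_in /Jn le_jn [v [/(eigE _ _ le_in)[_ v0 Ti]]].
  move=> /(eigE _ _ le_jn)[_ _]; rewrite Ti => /eqP.
  rewrite -subr_eq0 -scalerBl scaler_eq0 (negbTE v0) orbF -mulrBl mulf_eq0.
  rewrite invr_eq0 pnatr_eq0 (gtn_eqF hn) orbF subr_eq0 eqr_nat.
  by move/eqP.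
split.
- by move=> v [j /Jn le_jn Ev]; exact: (eigenset_piece hG hP le_jn Ev).
- by apply: lin_indep_mono iE => v [j _ Ev]; exists j.
- by move=> x Gx; exact: (piece_span_eigensets hG hP).
Qed.
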